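(* Let $X=(X_1,\dots,X_d)\sim \mathrm{mPH}(\boldsymbol{\pi},\mathcal{T})$ be a multivariate phase-type random vector. Then for every $u=(u_1,\dots,u_d)\in\mathbb{R}^d$ with $u_i>0$ for all $i$, the inner product $$\langle X,u\rangle=\sum_{i=1}^d X_i u_i$$ is univariate phase-type distributed.
   Context: mPH class. Let $\boldsymbol{\pi}=(\pi_1,\dots,\pi_p)$ be a probability row vector and let $\boldsymbol{T}_1,\dots,\boldsymbol{T}_d$ be real $p\times p$ sub-intensity matrices (nonnegative off-diagonal entries, strictly negative diagonal entries, nonpositive row sums) for which all states $1,\dots,p$ are transient (equivalently, each $\boldsymbol{T}_i$ is invertible). Let $\boldsymbol{e}$ be the column vector of ones in $\mathbb{R}^p$ and $\boldsymbol{t}_i=-\boldsymbol{T}_i\boldsymbol{e}$. For $i=1,\dots,d$ let $(J^{(i)}_t)_{t\ge 0}$ be a time-homogeneous Markov jump process on $\{1,\dots,p,p+1\}$ with $p+1$ absorbing, with transition intensities between the states $1,\dots,p$ given by $\boldsymbol{T}_i$ and intensities of jumping to $p+1$ given by $\boldsymbol{t}_i$. Assume that all the processes start in the same state, $J_0^{(1)}=\dots=J_0^{(d)}=:J_0$ with $\mathbb{P}(J_0=j)=\pi_j$ for $j=1,\dots,p$, and that the $d$ processes are conditionally independent given $J_0$. Put $X_i=\inf\{t>0: J^{(i)}_t=p+1\}$. Then $X=(X_1,\dots,X_d)$ is said to be mPH (multivariate phase-type) distributed, written $X\sim \mathrm{mPH}(\boldsymbol{\pi},\mathcal{T})$ with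 $\mathcal{T}=\{\boldsymbol{T}_1,\dots,\boldsymbol{T}_d\}$ (indexed by $i=1,\dots,d$). A univariate phase-type distribution is the distribution of the absorption time of a time-homogeneous Markov jump process on a finite state space $\{1,\dots,q,q+1\}$ with $1,\dots,q$ transient and $q+1$ absorbing, started in $\{1,\dots,q\}$ according to some initial distribution. *)

(* Defs.v *)
From HB Require Import structures.
From mathcomp Require Import all_boot all_order all_algebra.
From mathcomp Require Import all_classical all_reals all_analysis.

Set Implicit Arguments.
Unset Strict Implicit.
Unset Printing Implicit Defensive.

Import Order.TTheory GRing.Theory Num.Theory.
Import numFieldNormedType.Exports.

Local Open Scope classical_set_scope.
Local Open Scope ring_scope.

Definition probability_vector (R : realType) (p : nat) (pi : 'rV[R]_p) : Prop :=
  (forall j, 0 <= pi 0 j) /\ \sum_(j < p) pi 0 j = 1.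

(* Invertibility of [S] is the matrix form of the transience of all the
   states [1, ..., p]. *)
Record transient_subintensity (R : realType) (p : nat) (S : 'M[R]_p) : Prop := {
  subintensity_offdiag : forall j k, j != k -> 0 <= S j k;
  subintensity_diag : forall j, S j j < 0;
  subintensity_rowsum : forall j, \sum_(k < p) S j k <= 0;
  subintensity_transient : S \in unitmx }.

Definition exit_rates (R : realType) (p : nat) (S : 'M[R]_p) : 'cV[R]_p :=
  - (S *m const_mx 1).

(* States [1, ..., p] are [lshift 1 j] with [j : 'I_p]; the absorbing state
   [p + 1] is [cemetery p]. *)
Definition cemetery (p : nat) : 'I_(p + 1) := rshift p ord0.

Definition absorbing_intensity (R : realType) (p : nat) (S : 'M[R]_p) :
    'M[R]_(p + 1) :=
  block_mx S (exit_rates S) 0 0.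

Record transition_semigroup (R : realType) (n : nat) (L : 'M[R]_n)
    (F : R -> 'M[R]_n) : Prop := {
  semigroup_ge0 : forall t j k, 0 <= t -> 0 <= F t j k;
  semigroup_rowsum : forall t j, 0 <= t -> \sum_(k < n) F t j k = 1;
  semigroup_at0 : F 0 = 1%:M;
  semigroup_chapman_kolmogorov : forall s t, 0 <= s -> 0 <= t ->
    F (s + t) = F s *m F t;
  semigroup_intensity : forall j k,
    (fun h : R => (F h j k - (j == k)%:R) / h) @ 0^'+ --> L j k }.

Definition condp (d : measure_display) (Omega : measurableType d)
    (R : realType) (P : probability Omega R) (A B : set Omega) : R :=
  fine (P (A `&` B)) / fine (P B).

(* The sigma-algebra generated by the variables [J t], [t] in [D]. *)
Definition history (Omega S : Type) (R : realType) (J : R -> Omega -> S)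
    (D : set R) : set (set Omega) :=
  <<s \bigcup_(t in D) \bigcup_(k in [set: S]) [set J t @^-1` [set k]] >>.

(* Processes are indexed by [R], but only their values at times [t >= 0] are
   constrained.  Since the state space is finite, right continuity means being
   constant just after [t], and the existence of left limits that a path has
   only finitely many jumps in bounded time intervals. *)
Record markov_jump_process (d : measure_display) (Omega : measurableType d)
    (R : realType) (P : probability Omega R) (n : nat) (L : 'M[R]_n)
    (J : R -> Omega -> 'I_n) : Prop := {
  jump_measurable : forall t k, 0 <= t -> measurable (J t @^-1` [set k]);
  jump_right_continuous : forall w t, 0 <= t ->
    \forall s \near t^'+, J s w = J t w;
  jump_left_limits : forall w t, 0 < t ->
    exists k, \forall s \near t^'-, J s w = k;
  jump_markov : exists2 F : R -> 'M[R]_n, transition_semigroup L F &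
    forall (t h : R) (A : set Omega) (j k : 'I_n), 0 <= t -> 0 <= h ->
      history J `[0, t] A ->
      (0 < P (A `&` J t @^-1` [set j]))%E ->
      condp P (J (t + h) @^-1` [set k]) (A `&` J t @^-1` [set j]) = F h j k }.

(* [inf set0 = +oo]: the value is [+oo] when absorption never occurs. *)
Definition absorption_time (Omega : Type) (R : realType) (p : nat)
    (J : R -> Omega -> 'I_(p + 1)) (w : Omega) : \bar R :=
  ereal_inf [set t%:E | t in [set t : R | 0 < t /\ J t w = cemetery p]].

Definition conditionally_independent (d : measure_display)
    (Omega : measurableType d) (R : realType) (P : probability Omega R)
    (I : finType) (G : I -> set (set Omega)) (C : set Omega) : Prop :=
  forall A : I -> set Omega, (forall i, G i (A i)) ->
    condp P (\bigcap_(i in [set: I]) A i) C = \prod_(i : I) condp P (A i) C.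

Record mPH_processes (d : measure_display) (Omega : measurableType d)
    (R : realType) (P : probability Omega R) (n p : nat) (pi : 'rV[R]_p)
    (T : 'I_n -> 'M[R]_p) (J : 'I_n -> R -> Omega -> 'I_(p + 1)) : Prop := {
  mPH_jump : forall i,
    markov_jump_process P (absorbing_intensity (T i)) (J i);
  mPH_start : exists J0 : Omega -> 'I_(p + 1),
    [/\ forall i w, J i 0 w = J0 w,
        forall j : 'I_p, P (J0 @^-1` [set lshift 1 j]) = (pi 0 j)%:E &
        forall k : 'I_(p + 1), (0 < P (J0 @^-1` [set k]))%E ->
          conditionally_independent P
            (fun i => history (J i) `[0, +oo[) (J0 @^-1` [set k])] }.

(* [X ~ mPH(pi, T)]: the joint law of [X] is that of the vector of absorption
   times, the processes living on some probability space. *)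
Definition mPH (d : measure_display) (Omega : measurableType d)
    (R : realType) (P : probability Omega R) (n p : nat) (pi : 'rV[R]_p)
    (T : 'I_n -> 'M[R]_p) (X : {RV P >-> n.-tuple R}) :
    Prop :=
  exists (d' : measure_display) (Omega' : measurableType d')
    (Q : probability Omega' R) (J : 'I_n -> R -> Omega' -> 'I_(p + 1)),
    mPH_processes Q pi T J /\
    forall A : set (n.-tuple R), measurable A ->
      distribution P X A =
      Q [set w | exists2 x : n.-tuple R, A x &
                   forall i, absorption_time (J i) w = (tnth x i)%:E].

Definition phase_type (R : realType) (mu : set R -> \bar R) : Prop :=
  exists (q : nat) (alpha : 'rV[R]_q) (S : 'M[R]_q),
    [/\ probability_vector alpha, transient_subintensity S &
    exists (d : measure_display) (Omega : measurableType d)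
      (Q : probability Omega R) (J : R -> Omega -> 'I_(q + 1)),
      [/\ markov_jump_process Q (absorbing_intensity S) J,
          forall j : 'I_q, Q (J 0 @^-1` [set lshift 1 j]) = (alpha 0 j)%:E &
          forall A : set R, measurable A ->
            mu A = Q [set w | exists2 x : R, A x &
                                absorption_time J w = x%:E]]].

(* Main.v *)
(* Given J_0 = j, the vector X has independent phase-type components, so the
   law of <X, u> is the mixture, with weights pi_j, of convolutions of rescaled
   phase-type laws, and it suffices to realize rescalings, convolutions and
   mixtures by Markov jump processes.  A convolution is the absorption time of
   the process, on a product space, which follows the first process until its
   absorption and then the second one.  Its Markov property is checked by
   freezing the first coordinate (Fubini) and in infinitesimal form: up to an
   error o(h), uniform in the past, the transition probabilities over [t, t + h]
   are those of 1 + h L.  Comparing with the semigroup generated by L over many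
   small steps then gives the exact Markov property. *)

Require Import Defs.
From HB Require Import structures.
From mathcomp Require Import all_boot all_order all_algebra.
From mathcomp Require Import all_classical all_reals all_analysis.
From mathcomp Require Import measurable_realfun ring lra.

Set Implicit Arguments.
Unset Strict Implicit.
Unset Printing Implicit Defensive.

Import Order.TTheory GRing.Theory Num.Theory.
Import numFieldNormedType.Exports.

Local Open Scope classical_set_scope.
Local Open Scope ring_scope.

(** A Markov jump process requires a semigroup with prescribed intensities and exact conditional
    probabilities; for a concatenation these would involve convolution integrals of two semigroups.
    Estimates over one short step avoid them, provided that the error is at most [dl * h] for every
    event of the past: only then can a fixed event be carried through all the steps. The error is
    not weighted by the probability of that event, so a correction of order h^2 in absolute terms is
    negligible. Freezing a sample point is simplest when every path is absorbed for good at a finite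
    time, whereas the definition admits exceptional paths that leave the cemetery or never reach it.
    Each conditioned process is therefore modified on a null set before it is scaled and added. That
    absorption is almost surely finite is read off from the law of X, which charges only real
    vectors. A starting state of probability zero cannot be conditioned on; it has weight zero in
    the mixture, and regularity is required only of the components of positive weight. *)

Record generator (R : realType) (n : nat) (L : 'M[R]_n) : Prop := {
  generator_offdiag : forall j k, j != k -> 0 <= L j k;
  generator_rowsum : forall j, \sum_(k < n) L j k = 0 }.

(** * First-order expansions and the semigroup of a generator *)

Lemma near_rightP (R : realType) (x : R) (P : set R) :
  (\forall y \near x^'+, P y) <->
  exists2 e : R, 0 < e & forall y, x < y < x + e -> P y.
Proof.
split.
- move=> [e /= e0 H]; exists e => // y /andP[xy yxe]; apply: H => //=.
  by rewrite distrC ger0_norm ?subr_ge0 ?ltW// ltrBlDl.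
- move=> [e e0 H]; exists e => //= y /=; rewrite distrC => yx xy; apply: H.
  by rewrite xy /= -ltrBlDl -[y - x]ger0_norm ?subr_ge0 ?ltW.
Qed.

Lemma near_leftP (R : realType) (x : R) (P : set R) :
  (\forall y \near x^'-, P y) <->
  exists2 e : R, 0 < e & forall y, x - e < y < x -> P y.
Proof.
split.
- move=> [e /= e0 H]; exists e => // y /andP[xy yxe]; apply: H => //=.
  by rewrite ger0_norm ?subr_ge0 ?ltW// ltrBlDl addrC -ltrBlDl addrC; lra.
- move=> [e e0 H]; exists e => //= y /= yx xy. apply: H.
  by rewrite xy andbT; move: yx; rewrite ger0_norm ?subr_ge0 ?ltW//; lra.
Qed.

(** Multiplying by [h] turns the derivative at 0 into a first-order expansion with error [dl * h],
    the shape of all the local estimates and one in which errors add up over successive steps. *)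
Lemma intensityP (R : realType) (f : R -> R) (c l : R) :
  (fun h : R => (f h - c) / h) @ 0^'+ --> l <->
  forall dl, 0 < dl -> exists2 e : R, 0 < e &
    forall h, 0 < h < e -> `|f h - c - h * l| <= dl * h.
Proof.
have E h : 0 < h -> f h - c - h * l = - (l - (f h - c) / h) * h.
  by move=> h0; field; lra.
split.
- move=> /cvgrPdist_le H dl /H /near_rightP[e e0 {}H]; exists e => // h h0e.
  have h0 : 0 < h by case/andP: h0e.
  rewrite E// normrM normrN (gtr0_norm h0) ler_pM2r//.
  by have := H h; rewrite add0r => /(_ h0e).
- move=> H; apply/cvgrPdist_le => dl /H[e e0 {}H].
  apply/near_rightP; exists e => // h; rewrite add0r => h0e.
  have h0 : 0 < h by case/andP: h0e.
  by have := H h h0e; rewrite E// normrM normrN (gtr0_norm h0) ler_pM2r.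
Qed.

(** Both sides run over the triangle k + l < N, by antidiagonals on the left and by rows on the
    right: the rearrangement behind the Cauchy product of two exponential series. *)
Lemma sum_triangle (V : zmodType) (f : nat -> nat -> V) (N : nat) :
  \sum_(0 <= m < N) \sum_(0 <= k < m.+1) f k (m - k)%N =
  \sum_(0 <= k < N) \sum_(0 <= l < N - k) f k l.
Proof.
elim: N => [|N IH]; first by rewrite !big_nil.
rewrite big_nat_recr//= IH [in RHS]big_nat_recr//= subSnn big_nat1.
rewrite [X in _ + X]big_nat_recr//= subnn addrA -big_split/=; congr (_ + _).
rewrite !big_nat; apply: eq_bigr => k /andP[_ kN].
by rewrite subSn ?(ltnW kN)// big_nat_recr.
Qed.

Lemma cvg_sum_ord (R : realType) (n : nat) (f : 'I_n -> nat -> R)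
    (l : 'I_n -> R) :
  (forall i, f i N @[N --> \oo] --> l i) ->
  (\sum_(i < n) f i N) @[N --> \oo] --> \sum_(i < n) l i.
Proof.
move=> H; rewrite (_ : (fun N => _) = \sum_(i < n) f i); last first.
  by apply/funext => N; rewrite fct_sumE.
apply: (@big_ind2 _ _ (fun (a : nat -> R) b => a @ \oo --> b)) => //.
- exact: cvg_cst.
- by move=> a b a' b' ab a'b'; exact: cvgD.
Qed.

(* Uniformization: for [lam] dominating the diagonal of [- L], the matrix
   [S = 1 + L / lam] is stochastic, and the semigroup
   [exp (- lam t) * sum_k (lam t)^k / k! * S^k] is a series of nonnegative
   terms. *)
Section semigroup_existence.
Context (R : realType) (n : nat) (L : 'M[R]_n) (gL : generator L).

(** The sum dominates every [- L j j], which makes [S] nonnegative; the summand 1 keeps [lam]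
    invertible when the diagonal vanishes. *)
Let lam := 1 + \sum_(j < n) `|L j j|.
Let S : 'M[R]_n := 1%:M + lam^-1 *: L.

Let lam_gt0 : 0 < lam.
Proof. by rewrite ltr_wpDr// sumr_ge0. Qed.

Let S_ge0 i j : 0 <= S i j.
Proof.
rewrite !mxE; have [->|ij] := eqVneq i j; last first.
  by rewrite add0r mulr_ge0 ?(generator_offdiag gL)// invr_ge0 ltW.
have : `|L j j| <= lam.
  by rewrite /lam (bigD1 j)//= addrCA lerDl addr_ge0// sumr_ge0.
rewrite ler_norml => /andP[h _].
by rewrite -[1%:R](mulVf (lt0r_neq0 lam_gt0)) -mulrDr mulr_ge0 ?invr_ge0 ?(ltW lam_gt0)//; lra.
Qed.

Let S_sum i : \sum_j S i j = 1.
Proof.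
under eq_bigr do rewrite !mxE.
rewrite big_split/= -mulr_sumr (generator_rowsum gL) mulr0 addr0.
by rewrite (bigD1 i)//= eqxx big1 ?addr0// => j ji; rewrite eq_sym (negbTE ji).
Qed.

Let Sn_ge0 k i j : 0 <= (S ^+ k) i j.
Proof.
elim: k i j => [|k IH] i j; first by rewrite expr0 mxE ler0n.
by rewrite exprS -mulmxE mxE sumr_ge0// => l _; rewrite mulr_ge0.
Qed.

Let Sn_sum k i : \sum_j (S ^+ k) i j = 1.
Proof.
elim: k i => [|k IH] i.
  under eq_bigr do rewrite expr0 mxE.
  by rewrite (bigD1 i)//= eqxx big1 ?addr0// => j ji; rewrite eq_sym (negbTE ji).
under eq_bigr do rewrite exprS -mulmxE mxE.
rewrite exchange_big/=.
by under eq_bigr do rewrite -mulr_sumr IH mulr1.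
Qed.

Let Sn_le1 k i j : (S ^+ k) i j <= 1.
Proof. by rewrite -(Sn_sum k i) (bigD1 j)//= lerDl sumr_ge0. Qed.

Let ps t i j := [series exp_coeff (lam * t) k * (S ^+ k) i j]_k.

Let co_ge0 t k : 0 <= t -> 0 <= exp_coeff (lam * t) k.
Proof. by move=> t0; apply: exp_coeff_ge0; rewrite mulr_ge0// ltW. Qed.

Let tm_ge0 t i j k : 0 <= t -> 0 <= exp_coeff (lam * t) k * (S ^+ k) i j.
Proof. by move=> t0; rewrite mulr_ge0// co_ge0. Qed.

Let ps_nd t i j : 0 <= t -> nondecreasing_seq (ps t i j).
Proof.
by move=> t0; apply: nondecreasing_series => k _ _; exact: tm_ge0.
Qed.

Let co_nd t : 0 <= t -> nondecreasing_seq (series (exp_coeff (lam * t))).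
Proof.
by move=> t0; apply: nondecreasing_series => k _ _; exact: co_ge0.
Qed.

Let ps_cvg t i j : 0 <= t -> cvgn (ps t i j).
Proof.
move=> t0; apply: nondecreasing_is_cvgn; first exact: ps_nd.
exists (expR (lam * t)) => _ [N _ <-].
apply: (@le_trans _ _ (series (exp_coeff (lam * t)) N)); last first.
  by apply: nondecreasing_cvgn_le; [exact: co_nd|exact: is_cvg_series_exp_coeff].
by rewrite /ps /series/= ler_sum// => k _; rewrite ler_piMr// co_ge0.
Qed.

(** This is the exponential of [lam * t * S]. The factor [expR (- (lam * t))] that makes its rows
    sum to 1 enters only in [semigroup_exists]. *)
Let U t : 'M[R]_n := \matrix_(i, j) limn (ps t i j).

Let U_cvg t i j : 0 <= t -> ps t i j N @[N --> \oo] --> U t i j.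
Proof. by move=> t0; rewrite mxE; exact: ps_cvg. Qed.

Let ps_le_U t i j N : 0 <= t -> ps t i j N <= U t i j.
Proof.
by move=> t0; rewrite mxE; apply: nondecreasing_cvgn_le; [exact: ps_nd|exact: ps_cvg].
Qed.

Let ps_ge0 t i j N : 0 <= t -> 0 <= ps t i j N.
Proof. by move=> t0; rewrite /ps /series/= sumr_ge0// => k _; exact: tm_ge0. Qed.

Let U_sum t i : 0 <= t -> \sum_j U t i j = expR (lam * t).
Proof.
move=> t0; have h1 : (\sum_j ps t i j N) @[N --> \oo] --> \sum_j U t i j.
  by apply: cvg_sum_ord => j; exact: U_cvg.
have h2 : (\sum_j ps t i j N) @[N --> \oo] --> expR (lam * t).
  rewrite (_ : (fun N => _) = series (exp_coeff (lam * t))).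
    exact: is_cvg_series_exp_coeff.
  apply/funext => N; rewrite /ps /series/= exchange_big/=.
  by apply: eq_bigr => k _; rewrite -mulr_sumr Sn_sum mulr1.
exact: (cvg_unique _ h1 h2).
Qed.

Let exp_coeffD (x y : R) m : exp_coeff (x + y) m =
  \sum_(0 <= k < m.+1) exp_coeff x k * exp_coeff y (m - k)%N.
Proof.
rewrite /exp_coeff/= addrC exprDn mulr_suml big_mkord; apply: eq_bigr => i _.
have im : (i <= m)%N by rewrite -ltnS.
have fn0 (k : nat) : (factorial k)%:R != 0 :> R by rewrite pnatr_eq0 -lt0n fact_gt0.
have := congr1 (fun k : nat => k%:R : R) (bin_fact im); rewrite /= !natrM => e.
rewrite -mulr_natr -e; field.
by rewrite !fn0/= pnatr_eq0 -lt0n bin_gt0.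
Qed.

(** The terms [f k l] are nonnegative, so the sum over the square k, l < N lies between those over
    the triangles k + l < N and k + l < 2N. The square converges to the product of the limits, and
    both triangles are partial sums of the series at [s + t]. *)
Let U_mul s t i j : 0 <= s -> 0 <= t ->
  \sum_k U s i k * U t k j = U (s + t) i j.
Proof.
move=> s0 t0.
pose f k l := exp_coeff (lam * s) k * exp_coeff (lam * t) l * (S ^+ (k + l)) i j.
have f0 k l : 0 <= f k l by rewrite mulr_ge0// mulr_ge0// co_ge0.
have psD N : ps (s + t) i j N = \sum_(0 <= k < N) \sum_(0 <= l < N - k) f k l.
  rewrite -sum_triangle /ps /series/= !big_nat; apply: eq_bigr => m _.
  rewrite mulrDr exp_coeffD mulr_suml !big_nat; apply: eq_bigr => k /andP[_ km].
  by rewrite /f subnKC.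
have psM N : \sum_k ps s i k N * ps t k j N =
    \sum_(0 <= k < N) \sum_(0 <= l < N) f k l.
  under eq_bigr do rewrite /ps /series/= mulr_suml.
  rewrite exchange_big/=; apply: eq_bigr => a _.
  under eq_bigr do rewrite mulr_sumr.
  rewrite exchange_big/=; apply: eq_bigr => b _.
  rewrite /f exprD -mulmxE mxE mulr_sumr; apply: eq_bigr => k _.
  by rewrite mulrACA.
have c1 : (\sum_k ps s i k N * ps t k j N) @[N --> \oo] -->
    \sum_k U s i k * U t k j.
  by apply: cvg_sum_ord => k; apply: cvgM; exact: U_cvg.
have le1 N : ps (s + t) i j N <= \sum_k ps s i k N * ps t k j N.
  rewrite psD psM; apply: ler_sum => k _.
  rewrite [leRHS](big_cat_nat (n := N - k))//= ?leq_subr// lerDl.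
  by rewrite sumr_ge0.
have le2 N : \sum_k ps s i k N * ps t k j N <= ps (s + t) i j (N + N)%N.
  rewrite psD psM [leRHS](big_cat_nat (n := N))//= ?leq_addr//.
  rewrite -[leLHS]addr0 lerD//; last by rewrite sumr_ge0// => k _; rewrite sumr_ge0.
  rewrite !big_nat; apply: ler_sum => k /andP[_ kN].
  rewrite [leRHS](big_cat_nat (n := N))//= ?lerDl ?sumr_ge0//.
  by rewrite -addnBA ?leq_addr// ltnW.
have st0 : 0 <= s + t by rewrite addr_ge0.
apply/eqP; rewrite eq_le; apply/andP; split.
- rewrite -(cvg_lim _ c1)//; apply: limr_le; first by apply/cvg_ex; eexists; exact: c1.
  by near=> N; rewrite (le_trans (le2 N))// ps_le_U.
- rewrite -(cvg_lim _ (@U_cvg _ i j st0))//; apply: limr_le.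
    by apply/cvg_ex; eexists; exact: (@U_cvg _ i j st0).
  near=> N; rewrite (le_trans (le1 N))//; apply: ler_sum => k _.
  by rewrite ler_pM ?ps_ge0 ?ps_le_U.
Unshelve. all: by end_near. Qed.

(** The middle quantity is the tail of the series from index 2 on; the entries of [S ^+ k] lie in
    [0, 1], so the tail of the scalar exponential bounds it. *)
Let U_approx t i j : 0 <= t ->
  0 <= U t i j - (i == j)%:R - lam * t * S i j <= expR (lam * t) - 1 - lam * t.
Proof.
move=> t0; have ps2 : ps t i j 2 = (i == j)%:R + lam * t * S i j.
  rewrite /ps /series/= !big_nat_recr//= big_nil add0r /exp_coeff/=.
  by rewrite expr0 expr1 !fact0 factS fact0 !divr1 !expr0 expr1 mxE; lra.
rewrite -addrA -opprD -ps2 subr_ge0 ps_le_U//=.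
have h : (series (exp_coeff (lam * t)) N - (1 + lam * t)) @[N --> \oo] -->
   expR (lam * t) - (1 + lam * t).
  by apply: cvgB; [exact: is_cvg_series_exp_coeff|exact: cvg_cst].
have h' : (ps t i j N - ps t i j 2) @[N --> \oo] --> U t i j - ps t i j 2.
  by apply: cvgB; [exact: U_cvg|exact: cvg_cst].
rewrite -addrA -opprD.
rewrite -(cvg_lim _ h')// -(cvg_lim _ h)//; apply: ler_lim.
- by apply/cvg_ex; eexists; exact: h'.
- by apply/cvg_ex; eexists; exact: h.
near=> N; have N2 : (2 <= N)%N by near: N; exists 2%N.
have sp (g : nat -> R) : \sum_(0 <= k < N) g k =
    \sum_(0 <= k < 2) g k + \sum_(2 <= k < N) g k by rewrite -big_cat_nat.
have e2 : \sum_(0 <= k < 2) exp_coeff (lam * t) k = 1 + lam * t.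
  by rewrite !big_nat_recr//= big_nil add0r /exp_coeff/= expr0 expr1 factS fact0 !divr1.
have : \sum_(2 <= k < N) exp_coeff (lam * t) k * (S ^+ k) i j <=
    \sum_(2 <= k < N) exp_coeff (lam * t) k.
  by apply: ler_sum => k _; rewrite ler_piMr// co_ge0.
by rewrite /ps /series/= !sp e2; lra.
Unshelve. all: by end_near. Qed.

Lemma semigroup_exists : exists F : R -> 'M[R]_n, transition_semigroup L F.
Proof.
exists (fun t => expR (- (lam * t)) *: U t).
have U_ge0 t i j : 0 <= t -> 0 <= U t i j.
  by move=> t0; rewrite (le_trans _ (@ps_le_U _ i j 0 t0))// ps_ge0.
split.
- by move=> t j k t0; rewrite mxE mulr_ge0 ?expR_ge0// U_ge0.
- move=> t j t0; under eq_bigr do rewrite mxE.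
  by rewrite -mulr_sumr U_sum// -expRD addrC subrr expR0.
- apply/matrixP => i j; rewrite mxE mulr0 oppr0 expR0 mul1r [RHS]mxE.
  have := @U_approx 0 i j (lexx _); rewrite mulr0 mul0r expR0 subrr !subr0.
  by rewrite -eq_le eq_sym subr_eq0 => /eqP.
- move=> s t s0 t0; apply/matrixP => i j; rewrite !mxE -[limn _]/(limn _).
  have := @U_mul s t i j s0 t0; rewrite [in RHS]mxE => <-.
  rewrite mulrDr opprD expRD mulr_sumr; apply: eq_bigr => k _.
  by rewrite [in RHS]mxE [X in _ = _ * X]mxE mulrACA.
move=> j k; rewrite (_ : (fun h => _) =
  (fun h => ((fun t => (expR (- (lam * t)) *: U t) j k) h - (j == k)%:R) / h))//.
apply/intensityP => dl dl0.
(* With x = lam h, the remainder splits into three terms bounded by x^2, h |L j k| x and 2 x^2,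
   whose sum is [C * h ^+ 2]. *)
pose C := 3 * lam ^+ 2 + `|L j k| * lam.
have C0 : 0 < C by rewrite /C ltr_pwDl ?mulr_gt0 ?exprn_gt0// mulr_ge0// ltW.
(* The second bound gives x < 1/2, where 1 / (1 - x) <= 1 + x + 2 x^2; this yields the quadratic
   bound on [expR x]. *)
exists (Num.min (dl / C) (lam^-1 / 2)).
  by rewrite lt_min !divr_gt0// invr_gt0.
move=> h /andP[h0]; rewrite lt_min => /andP[hC hl].
pose x := lam * h.
have x0 : 0 < x by rewrite mulr_gt0.
have x2 : x < 1/2.
  by rewrite /x mulrC -ltr_pdivlMr// mul1r mulrC.
have [r0 rle] := andP (@U_approx h j k (ltW h0)).
move: r0 rle; set r := _ - _ - _ => r0 rle.
have SE : lam * h * S j k = x * (j == k)%:R + h * L j k.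
  by rewrite /x !mxE; field; exact: lt0r_neq0.
have UE : U h j k = (j == k)%:R + (x * (j == k)%:R + h * L j k) + r.
  by rewrite -SE /r; ring.
have e1 : 1 - x <= expR (- x) by rewrite (le_trans _ (expR_ge1Dx _)).
have e2 : expR (- x) <= 1 by rewrite -expR0 ler_expR; lra.
have e3 : 1 + x <= expR x by exact: expR_ge1Dx.
have e4 : expR (- x) * expR x = 1 by rewrite -expRD addrC subrr expR0.
have e5 : expR x * (1 - x) <= 1 by rewrite -[leRHS]e4 [leRHS]mulrC ler_wpM2l// expR_ge0.
have e6 : expR x <= 1 + x + 2 * x ^+ 2 by nra.
have e7 : 0 <= expR (-x) by exact: expR_ge0.
rewrite mxE UE -/x.
have -> : expR (- x) * ((j == k)%:R + (x * (j == k)%:R + h * L j k) + r) -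
  (j == k)%:R - h * L j k = (j == k)%:R * (expR (-x) * (1 + x) - 1) +
    (h * L j k * (expR (- x) - 1) + expR (- x) * r) by ring.
have hx : h * C = 3 * x * lam + `|L j k| * x by rewrite /C /x; ring.
have hC' : h * C <= dl by rewrite -ler_pdivlMr// ltW.
rewrite (le_trans (ler_normD _ _))//.
have n1 : `|(j == k)%:R * (expR (- x) * (1 + x) - 1)| <= x ^+ 2.
  rewrite normrM normr_nat; apply: (@le_trans _ _ (1 * `|expR (- x) * (1 + x) - 1|)).
    by rewrite ler_wpM2r// lern1; case: (j == k).
  rewrite mul1r ler_norml; apply/andP; split; nra.
have n2 : `|h * L j k * (expR (- x) - 1)| <= h * `|L j k| * x.
  rewrite !normrM (gtr0_norm h0) ler_wpM2l ?mulr_ge0 ?(ltW h0)//.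
  by rewrite ler_norml; apply/andP; split; lra.
have n3 : `|expR (- x) * r| <= 2 * x ^+ 2.
  rewrite ger0_norm ?mulr_ge0//; move: rle; rewrite -/x => rle.
  have : r <= 2 * x ^+ 2 by lra.
  by nra.
rewrite (le_trans (lerD n1 (ler_normD _ _)))//.
rewrite (le_trans (lerD (lexx _) (lerD n2 n3)))//.
have -> : x ^+ 2 + (h * `|L j k| * x + 2 * x ^+ 2) = (h * C) * h.
  by rewrite hx /x; ring.
by rewrite ler_wpM2r// ltW.
Qed.

End semigroup_existence.

(** * Infinitesimal Markov property *)

Section pr.
Context (d : measure_display) (Omega : measurableType d) (R : realType).
Context (P : probability Omega R).
Implicit Types A B : set Omega.

Definition pr A : R := fine (P A).

Lemma prK A : measurable A -> P A = (pr A)%:E.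
Proof. by move=> mA; rewrite /pr fineK// fin_num_measure. Qed.

Lemma pr_ge0 A : 0 <= pr A.
Proof. by rewrite /pr fine_ge0. Qed.

Lemma prT : pr setT = 1.
Proof. by rewrite /pr probability_setT. Qed.

Lemma pr0 : pr set0 = 0.
Proof. by rewrite /pr measure0. Qed.

Lemma le_pr A B : measurable A -> measurable B -> A `<=` B -> pr A <= pr B.
Proof.
by move=> mA mB AB; rewrite -lee_fin -!prK//; apply: le_measure => //; rewrite inE.
Qed.

Lemma pr_le1 A : measurable A -> pr A <= 1.
Proof. by move=> mA; rewrite -prT le_pr. Qed.

Lemma pr_fibers (n : nat) (K : Omega -> 'I_n) A :
  (forall k, measurable (K @^-1` [set k])) -> measurable A ->
  pr A = \sum_(k < n) pr (A `&` K @^-1` [set k]).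
Proof.
move=> mK mA.
have mAK k : measurable (A `&` K @^-1` [set k]) by exact: measurableI.
have AE : \big[setU/set0]_(k < n) (A `&` K @^-1` [set k]) = A.
  rewrite (eq_bigl (fun k : 'I_n => k \in (predT : {pred 'I_n})))// -bigcup_pred.
  apply/seteqP; split => [w [k _ []]//|w Aw].
  by exists (K w).
apply/EFin_inj; rewrite -prK// -{1}AE measure_bigsetU_ord//.
  by rewrite -sumEFin; apply: eq_bigr => k _; exact: prK.
by move=> i j _ _ [w [[_ /= Ki] [_ /= Kj]]]; rewrite -Ki -Kj.
Qed.

End pr.

Section history.
Context (Omega S : Type) (R : realType) (J : R -> Omega -> S).
Implicit Types D : set R.

Lemma historyT D : history J D setT.
Proof.
by rewrite -(setD0 setT); apply: sigma_algebraCD; exact: sigma_algebra0.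
Qed.

Lemma historyC D A : history J D A -> history J D (~` A).
Proof. by move=> hA; rewrite -setTD; exact: sigma_algebraCD. Qed.

Lemma history_bigcup D (F : nat -> set Omega) :
  (forall i, history J D (F i)) -> history J D (\bigcup_i F i).
Proof. by move=> hF; exact: sigma_algebra_bigcup. Qed.

Lemma historyU D A B : history J D A -> history J D B -> history J D (A `|` B).
Proof.
move=> hA hB; rewrite -bigcup2E; apply: history_bigcup => -[|[|k]]//=.
exact: sigma_algebra0.
Qed.

Lemma historyI D A B : history J D A -> history J D B -> history J D (A `&` B).
Proof.
move=> hA hB; rewrite -[A `&` B]setCK setCI; apply: historyC.
by apply: historyU; exact: historyC.
Qed.

Lemma history_state D t k : D t -> history J D (J t @^-1` [set k]).
Proof. by move=> Dt; apply: sub_sigma_algebra; exists t => //; exists k. Qed.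

Lemma sub_history D D' : D `<=` D' -> history J D `<=` history J D'.
Proof.
move=> DD'; apply: sub_sigma_algebra2 => A [t Dt [k _ ->]].
by exists t; [exact: DD'|exists k].
Qed.

End history.

(* Transfers events from the history of [J'] to that of [J] when the two
   processes are related only on the event [E]. *)
Lemma history_trace (Om S Om' S' W : Type) (R : realType)
    (J : R -> Om -> S) (D : set R) (J' : R -> Om' -> S') (D' : set R)
    (E : set W) (phi : W -> Om') (psi : W -> Om) :
  (forall t k, D' t -> exists2 B, history J D B &
    phi @^-1` (J' t @^-1` [set k]) `&` E = psi @^-1` B `&` E) ->
  forall A, history J' D' A -> exists2 B, history J D B &
    phi @^-1` A `&` E = psi @^-1` B `&` E.
Proof.
move=> H; apply: smallest_sub; last first.
  by move=> A [t Dt [k _ ->]]; exact: H.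
split.
- by exists set0; [exact: sigma_algebra0|rewrite !preimage_set0].
- move=> A [B hB AB]; exists (~` B); first exact: historyC.
  rewrite setTD; apply/seteqP; split => w [/= nA Ew]; split => //= Bw.
    by apply: nA; have [] : (phi @^-1` A `&` E) w by rewrite AB.
  by apply: nA; have [] : (psi @^-1` B `&` E) w by rewrite -AB.
- move=> F /= HF.
  have [G HG] := choice (fun n => let: ex_intro2 B hB e := HF n in
    ex_intro (fun B => history J D B /\ phi @^-1` F n `&` E = psi @^-1` B `&` E)
      B (conj hB e)).
  exists (\bigcup_n G n); first by apply: history_bigcup => n; have [] := HG n.
  rewrite !preimage_bigcup !setI_bigcupl; apply: eq_bigcupr => n _.
  by have [] := HG n.
Qed.

Section telescoping.
Context (R : realType) (n : nat) (L : 'M[R]_n) (F : R -> 'M[R]_n).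
Context (LF : transition_semigroup L F).

(** One [e] serves all the entries since there are finitely many. The case h = 0 is included because
    the telescoping may use steps of length 0. *)
Lemma semigroup_approx dl : 0 < dl -> exists2 e : R, 0 < e &
  forall h, 0 <= h < e -> forall j k,
    `|F h j k - ((j == k)%:R + h * L j k)| <= dl * h.
Proof.
move=> dl0.
have : \forall h \near 0^'+, forall jk : 'I_n * 'I_n,
    `|F h jk.1 jk.2 - ((jk.1 == jk.2)%:R + h * L jk.1 jk.2)| <= dl * h.
  apply: filter_forall => -[j k] /=.
  have /intensityP/(_ _ dl0)[e e0 H] := @semigroup_intensity _ _ _ _ LF j k.
  apply/near_rightP; exists e => // h; rewrite add0r => he.
  by rewrite opprD addrA; exact: H.
move=> /near_rightP[e e0 H]; exists e => // h /andP[h0 he] j k.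
move: h0; rewrite le_eqVlt => /orP[/eqP <-|h0].
  by rewrite (semigroup_at0 LF) mxE mul0r addr0 subrr normr0 mulr0.
by apply: (H h _ (j, k)); rewrite add0r h0.
Qed.

(* Each of the [h / x] steps of length [x] costs [dl * x], since a stochastic
   matrix contracts the l1 norm; the total error [dl * h] is arbitrary. *)
Lemma semigroup_telescope (p : R -> 'I_n -> R) :
  (forall dl, 0 < dl -> exists2 e : R, 0 < e &
    forall s h, 0 <= s -> 0 <= h < e ->
      \sum_k `|p (s + h) k - \sum_i p s i * F h i k| <= dl * h) ->
  forall h k, 0 <= h -> p h k = \sum_i p 0 i * F h i k.
Proof.
move=> H h k h0.
suff E dl : 0 < dl -> `|p h k - \sum_i p 0 i * F h i k| <= dl * h.
  apply/eqP; rewrite -subr_eq0 -normr_le0; apply/ler_addgt0Pl => e e0.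
  (* Dividing by [1 + h] rather than by [h] covers h = 0. *)
  rewrite addr0 (le_trans (E (e / (1 + h)) _)) ?divr_gt0//; first by lra.
  by rewrite mulrAC ler_pdivrMr ?ler_pM2l//; lra.
move=> dl0; have [e e0 He] := H _ dl0.
have [m hm] : exists m : nat, h / m.+1%:R < e.
  exists (Num.truncn (h / e)).
  rewrite ltr_pdivrMr ?ltr0n// mulrC -ltr_pdivrMr//.
  by rewrite truncnS_gt ?num_real.
have m0 : m.+1%:R != 0 :> R by rewrite pnatr_eq0.
pose x := h / m.+1%:R.
have x0 : 0 <= x by rewrite divr_ge0.
have key q : \sum_j `|p (q%:R * x) j - \sum_i p 0 i * F (q%:R * x) i j| <=
    q%:R * (dl * x).
  elim: q => [|q IH].
    rewrite !mul0r big1// => j _; rewrite (semigroup_at0 LF).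
    rewrite (bigD1 j)//= mxE eqxx mulr1 big1 ?addr0 ?subrr ?normr0//.
    by move=> i ij; rewrite mxE (negbTE ij) mulr0.
  have qx0 : 0 <= q%:R * x by rewrite mulr_ge0.
  have -> : q.+1%:R * x = q%:R * x + x by rewrite -natr1 mulrDl mul1r.
  have := He (q%:R * x) x qx0; rewrite x0 hm => /(_ isT) h1.
  have h2 : \sum_j `|\sum_i p (q%:R * x) i * F x i j -
      \sum_i p 0 i * F (q%:R * x + x) i j| <= q%:R * (dl * x).
    apply: le_trans IH.
    pose D i := p (q%:R * x) i - \sum_l p 0 l * F (q%:R * x) l i.
    have E j : \sum_i p (q%:R * x) i * F x i j -
        \sum_i p 0 i * F (q%:R * x + x) i j = \sum_i D i * F x i j.
      under [RHS]eq_bigr do rewrite mulrBl.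
      rewrite sumrB; congr (_ - _).
      under [RHS]eq_bigr do rewrite mulr_suml.
      rewrite exchange_big/=; apply: eq_bigr => i _.
      rewrite (semigroup_chapman_kolmogorov LF)// mxE mulr_sumr.
      by apply: eq_bigr => l _; rewrite mulrA.
    under eq_bigr do rewrite E.
    apply: (@le_trans _ _ (\sum_j \sum_i `|D i| * F x i j)).
      apply: ler_sum => j _; apply: le_trans (ler_norm_sum _ _ _) _.
      apply: ler_sum => i _.
      by rewrite normrM (ger0_norm (semigroup_ge0 LF _ _ x0)).
    rewrite exchange_big/=; apply: ler_sum => i _.
    by rewrite -mulr_sumr (semigroup_rowsum LF)// mulr1.
  have -> : q.+1%:R * (dl * x) = dl * x + q%:R * (dl * x).
    by rewrite -natr1; ring.
  apply: le_trans (lerD h1 h2); rewrite -big_split/=; apply: ler_sum => j _.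
  by apply: le_trans (ler_normD _ _); rewrite addrA subrK.
have mx : m.+1%:R * x = h by rewrite /x mulrC divfK.
have := key m.+1; rewrite mx mulrCA mx; apply: le_trans.
by rewrite [leRHS](bigD1 k)//= lerDl sumr_ge0.
Qed.

End telescoping.

Section infinitesimal.
Context (d : measure_display) (Omega : measurableType d) (R : realType).
Context (P : probability Omega R) (n : nat).

Record jump_paths (J : R -> Omega -> 'I_n) : Prop := {
  paths_measurable : forall t k, 0 <= t -> measurable (J t @^-1` [set k]);
  paths_right_continuous : forall w t, 0 <= t ->
    \forall s \near t^'+, J s w = J t w;
  paths_left_limits : forall w t, 0 < t ->
    exists k, \forall s \near t^'-, J s w = k }.

(* An infinitesimal form of the Markov property mentioning only the
   intensities: unlike the one with a semigroup, it is verified for a new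
   process by local estimates. *)
Definition inf_markov (L : 'M[R]_n) (J : R -> Omega -> 'I_n) : Prop :=
  forall dl, 0 < dl -> exists2 e : R, 0 < e &
    forall h t A j k, 0 <= h < e -> 0 <= t -> history J `[0, t] A ->
    `|pr P (A `&` J t @^-1` [set j] `&` J (t + h) @^-1` [set k]) -
      pr P (A `&` J t @^-1` [set j]) * ((j == k)%:R + h * L j k)| <= dl * h.

Lemma history_measurable (J : R -> Omega -> 'I_n) D A : jump_paths J ->
  D `<=` `[0, +oo[ -> history J D A -> measurable A.
Proof.
move=> pJ D0; move: A; apply: smallest_sub; first exact: sigma_algebra_measurable.
move=> A [t /D0/=]; rewrite in_itv/= andbT => t0 [k _ ->].
exact: paths_measurable.
Qed.

Lemma history_itv_measurable (J : R -> Omega -> 'I_n) t A : jump_paths J ->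
  history J `[0, t] A -> measurable A.
Proof.
move=> pJ; apply: history_measurable pJ _.
by move=> s /=; rewrite !in_itv/= andbT => /andP[].
Qed.

(** Fix the event [B] of the past of [t] and telescope the masses of [B] on the states at time
    [t + s]. Since [B] also belongs to the past of [t + s], each further step obeys the
    infinitesimal property. At s = 0 all the mass sits at [j], which leaves the single entry
    [F h j k]. *)
Lemma inf_markov_jump_process (L : 'M[R]_n) (J : R -> Omega -> 'I_n) :
  generator L -> jump_paths J -> inf_markov L J -> markov_jump_process P L J.
Proof.
move=> gL pJ iJ; have [F LF] := semigroup_exists gL.
split; [exact: paths_measurable|exact: paths_right_continuous|
  exact: paths_left_limits|].
exists F => // t h A j k t0 h0 hA.
have mJ s i : 0 <= s -> measurable (J s @^-1` [set i]).
  by move=> s0; exact: paths_measurable.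
set B := A `&` _ => B0.
have hB : history J `[0, t] B.
  by apply: historyI => //; apply: history_state; rewrite /= in_itv/= t0 lexx.
have mB : measurable B by exact: history_itv_measurable pJ hB.
pose p s i := pr P (B `&` J (t + s) @^-1` [set i]).
have E : p h k = \sum_i p 0 i * F h i k.
  apply: (semigroup_telescope LF) => // dl dl0.
  have n0 : (0 < n)%N by exact: leq_ltn_trans (leq0n k) (ltn_ord k).
  have nn0 : 0 < n%:R * n%:R * 2 :> R by rewrite !mulr_gt0// ltr0n.
  (* Each of the n^2 pairs of states contributes two errors, one from [inf_markov] and one from
     replacing 1 + x L by [F x]. *)
  have c0 : 0 < dl / (n%:R * n%:R * 2) by rewrite divr_gt0.
  have [e1 e10 H1] := semigroup_approx LF c0.
  have [e2 e20 H2] := iJ _ c0.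
  exists (Num.min e1 e2); first by rewrite lt_min e10.
  move=> s x s0 /andP[x0]; rewrite lt_min => /andP[xe1 xe2].
  have ts0 : 0 <= t + s by rewrite addr_ge0.
  have hBs : history J `[0, t + s] B.
    apply: sub_history hB => y /=; rewrite !in_itv/= => /andP[-> yt].
    by rewrite (le_trans yt)// lerDl.
  apply: (@le_trans _ _ (\sum_(l < n) \sum_(i < n) dl / (n%:R * n%:R * 2) * x * 2)).
    apply: ler_sum => l _.
    rewrite /p (@pr_fibers _ _ _ P _ (J (t + s))); [|by move=> ?; exact: mJ|].
      rewrite -sumrB; apply: le_trans (ler_norm_sum _ _ _) _.
      apply: ler_sum => i _.
      have a1 := H1 x; rewrite x0 xe1 in a1; have {}a1 := a1 isT i l.
      have a2 := H2 x (t + s) B i l; rewrite x0 xe2 in a2; have {}a2 := a2 isT ts0 hBs.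
      rewrite setIAC addrA; move: a2; set a := pr P _; set b := pr P _ => a2.
      have b01 : 0 <= b <= 1.
        by rewrite pr_ge0 pr_le1//; apply: measurableI => //; exact: mJ.
      rewrite (_ : a - b * F x i l = (a - b * ((i == l)%:R + x * L i l)) -
         b * (F x i l - ((i == l)%:R + x * L i l))); last by ring.
      apply: le_trans (ler_normB _ _) _; rewrite mulr_natr mulr2n lerD//.
      rewrite normrM (ger0_norm (proj1 (andP b01))) -[leRHS]mul1r.
      by case/andP: b01 => b0 b1; rewrite ler_pM.
    by apply: measurableI => //; apply: mJ; rewrite addrA addr_ge0.
  rewrite !sumr_const !card_ord -mulrnA -[leLHS]mulr_natr natrM le_eqVlt; apply/orP; left; apply/eqP.
  by field; rewrite pnatr_eq0 -lt0n.
rewrite /condp [X in P X]setIC.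
have -> : fine (P (B `&` J (t + h) @^-1` [set k])) = p h k by [].
rewrite -/(pr P B); have Bp : pr P B != 0.
  by rewrite gt_eqF// fine_gt0// B0/= -ge0_fin_numE// fin_num_measure.
rewrite E (bigD1 j)//= big1 ?addr0.
  have -> : p 0 j = pr P B by rewrite /p addr0 /B -setIA setIid.
  by rewrite mulrC mulKf.
move=> i ij; suff -> : p 0 i = 0 by rewrite mul0r.
rewrite /p addr0 -(pr0 P); congr pr.
by apply/seteqP; split => // w [[_ /= wj] wi]; move: ij; rewrite -wi -wj eqxx.
Qed.

Lemma markov_jump_process_paths (L : 'M[R]_n) (J : R -> Omega -> 'I_n) :
  markov_jump_process P L J -> jump_paths J.
Proof. by case. Qed.

Lemma markov_jump_process_inf (L : 'M[R]_n) (J : R -> Omega -> 'I_n) :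
  markov_jump_process P L J -> inf_markov L J.
Proof.
move=> mpJ; have pJ := markov_jump_process_paths mpJ.
have [F LF H] := jump_markov mpJ => dl dl0.
have [e e0 He] := semigroup_approx LF dl0; exists e => // h t A j k he t0 hA.
have [h0 _] := andP he.
have mA := history_itv_measurable pJ hA.
set B := A `&` _; have mB : measurable B.
  by apply: measurableI => //; exact: paths_measurable.
have mBk : measurable (B `&` J (t + h) @^-1` [set k]).
  by apply: measurableI => //; apply: paths_measurable => //; rewrite addr_ge0.
have -> : pr P (B `&` J (t + h) @^-1` [set k]) = pr P B * F h j k.
  (* The Markov property speaks only of events of positive probability; for a null [B] both sides
     vanish. *)
  have [PB|PB] := eqVneq (P B) 0%E.
    have : pr P (B `&` J (t + h) @^-1` [set k]) <= pr P B by rewrite le_pr.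
    rewrite [X in _ <= X](_ : pr P B = 0) ?/pr ?PB// mul0r => le0.
    by apply/eqP; rewrite eq_le le0 fine_ge0.
  rewrite -(H t h A j k t0 h0 hA) ?lt0e ?PB ?measure_ge0//.
  rewrite /condp [X in P X]setIC -/B [RHS]mulrC -mulrA mulVf ?mulr1//.
  by rewrite fine_eq0 ?fin_num_measure.
rewrite -mulrBr normrM (ger0_norm (pr_ge0 _ _)) -[leRHS]mul1r.
by rewrite ler_pM ?pr_ge0 ?pr_le1// He.
Qed.

End infinitesimal.

(** * Processes with a regular absorption time *)

Lemma measurable_fun_le (d : measure_display) (T : measurableType d)
    (R : realType) (f : T -> R) :
  (forall t, measurable [set w | f w <= t]) -> measurable_fun setT f.
Proof.
move=> H _; apply: (measurability _ (RGenOInfty.measurableE R)) => //.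
move=> _ [_ [x ->] <-]; rewrite setTI.
rewrite (_ : _ @^-1` _ = ~` [set w | f w <= x]); first exact: measurableC.
apply/seteqP; split => w /=; rewrite in_itv/= andbT ltNge; first by move/negP.
by move=> /negP.
Qed.

(** For a = 0 the infimum is not attained, time 0 being excluded; hence the approach by [a + e]. *)
Lemma ereal_inf_ray (R : realType) (a : R) : 0 <= a ->
  ereal_inf [set t%:E | t in [set t : R | 0 < t /\ a <= t]] = a%:E.
Proof.
move=> a0; apply/eqP; rewrite eq_le; apply/andP; split; last first.
  by apply: le_ereal_inf_tmp => _ [t [_ at_] <-]; rewrite lee_fin.
apply/lee_addgt0Pr => e e0; apply: ereal_inf_lbound.
exists (a + e); last by rewrite EFinD.
by split; [rewrite ltr_wpDl|rewrite lerDl ltW].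
Qed.

Lemma pr_ae (d : measure_display) (Omega : measurableType d) (R : realType)
    (P : probability Omega R) (N A B : set Omega) :
  measurable N -> P N = 0%E -> measurable A -> measurable B ->
  A `&` ~` N = B `&` ~` N -> pr P A = pr P B.
Proof.
move=> mN N0 mA mB AB.
have H X : measurable X -> P X = P (X `&` ~` N).
  move=> mX; have mXN : measurable (X `&` N) by exact: measurableI.
  have mXC : measurable (X `&` ~` N) by apply: measurableI => //; exact: measurableC.
  rewrite -{1}(setUIDK X N) setDE measureU//; last first.
    by rewrite setIACA setICr setI0.
  rewrite [X in (X + _)%E](_ : _ = 0%E) ?add0e//.
  by apply/eqP; rewrite eq_le measure_ge0 andbT -N0 le_measure ?inE.
by rewrite /pr H// AB -H.
Qed.

Section absorbing_intensity.
Context (R : realType) (q : nat) (S : 'M[R]_q).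
Let L := absorbing_intensity S.

Lemma absorbing_transient j k : L (lshift 1 j) (lshift 1 k) = S j k.
Proof. by rewrite /L /absorbing_intensity block_mxEul. Qed.

Lemma absorbing_exit j : L (lshift 1 j) (cemetery q) = - \sum_k S j k.
Proof.
rewrite /L /absorbing_intensity block_mxEur !mxE; congr (- _).
by apply: eq_bigr => k _; rewrite mxE mulr1.
Qed.

Lemma absorbing_cemetery k : L (cemetery q) k = 0.
Proof.
by case: (split_ordP k) => i ->; rewrite /L /absorbing_intensity
  ?block_mxEdl ?block_mxEdr mxE.
Qed.

Lemma ord_cemetery (k : 'I_(q + 1)) :
  k = cemetery q \/ exists j, k = lshift 1 j.
Proof.
case: (split_ordP k) => i ->; [by right; exists i|left].
by rewrite /cemetery (ord1 i).
Qed.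

Lemma lshift_neq_cemetery (j : 'I_q) : lshift 1 j != cemetery q.
Proof. by rewrite eq_lrshift. Qed.

Lemma absorbing_generator : transient_subintensity S -> generator L.
Proof.
move=> tS; split=> [j k|j].
  have [->|[a ->]] := ord_cemetery j; first by rewrite absorbing_cemetery.
  have [-> _|[b ->]] := ord_cemetery k.
    by rewrite absorbing_exit oppr_ge0 (subintensity_rowsum tS).
  rewrite absorbing_transient => ab; apply: (subintensity_offdiag tS).
  by apply: contra ab => /eqP ->.
have [->|[a ->]] := ord_cemetery j.
  by apply: big1 => k _; rewrite absorbing_cemetery.
rewrite big_split_ord/= big_ord1 -/(cemetery q) absorbing_exit.
by under eq_bigr do rewrite absorbing_transient; rewrite addrN.
Qed.

End absorbing_intensity.

(** The constant row with mass 1 at [c] satisfies the one-step estimate, because row [c] of [L]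
    vanishes and [F x c] differs from it by o(x); telescoping then shows that it is invariant under
    [F]. *)
Lemma semigroup_absorbing (R : realType) (n : nat) (L : 'M[R]_n) F c :
  transition_semigroup L F -> (forall k, L c k = 0) ->
  forall h k, 0 <= h -> F h c k = (c == k)%:R.
Proof.
move=> LF Lc h k h0.
have c1 (f : 'I_n -> R) : \sum_i (c == i)%:R * f i = f c.
  rewrite (bigD1 c)//= eqxx mul1r big1 ?addr0// => i ic.
  by rewrite eq_sym (negbTE ic) mul0r.
have := semigroup_telescope (p := fun _ i => (c == i)%:R) LF.
move=> /(_ _ h k h0)->; rewrite ?c1// => dl dl0.
have n0 : (0 < n)%N by exact: leq_ltn_trans (leq0n k) (ltn_ord k).
have n0R : 0 < n%:R :> R by rewrite ltr0n.
have [e e0 He] := semigroup_approx LF (divr_gt0 dl0 n0R).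
exists e => // s x _ xe.
apply: (@le_trans _ _ (\sum_(j < n) dl / n%:R * x)).
  apply: ler_sum => j _; rewrite c1 distrC.
  by have := He x xe c j; rewrite Lc mulr0 addr0.
rewrite sumr_const card_ord -[leLHS]mulr_natr le_eqVlt; apply/orP; left.
by apply/eqP; field; rewrite lt0r_neq0.
Qed.

(** The last clause holds on every path: the cemetery is never left and [tau] is the exact, finite
    absorption time. It can thus be used at a frozen sample point of a product without exceptional
    sets. A start in the cemetery corresponds to [tau w = 0]. *)
Record regular_process (d : measure_display) (Omega : measurableType d)
    (R : realType) (P : probability Omega R) (q : nat) (alpha : 'rV[R]_q)
    (S : 'M[R]_q) (J : R -> Omega -> 'I_(q + 1)) (tau : Omega -> R) : Prop := {
  regular_paths : jump_paths J;
  regular_inf_markov : inf_markov P (absorbing_intensity S) J;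
  regular_start : forall j, pr P (J 0 @^-1` [set lshift 1 j]) = alpha 0 j;
  regular_time_ge0 : forall w, 0 <= tau w;
  regular_timeP : forall w t, 0 <= t -> J t w = cemetery q <-> tau w <= t }.

Definition regular_phase_type (R : realType) (mu : set R -> R) : Prop :=
  exists (q : nat) (alpha : 'rV[R]_q) (S : 'M[R]_q),
    [/\ probability_vector alpha, transient_subintensity S &
    exists (d : measure_display) (Omega : measurableType d)
      (P : probability Omega R) (J : R -> Omega -> 'I_(q + 1))
      (tau : Omega -> R), regular_process P alpha S J tau /\
      forall A, measurable A -> mu A = pr P (tau @^-1` A)].

Section regular_process_lemmas.
Context (d : measure_display) (Omega : measurableType d) (R : realType).
Context (P : probability Omega R) (q : nat) (alpha : 'rV[R]_q) (S : 'M[R]_q).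
Context (J : R -> Omega -> 'I_(q + 1)) (tau : Omega -> R).
Hypothesis rJ : regular_process P alpha S J tau.

Lemma regular_time_measurable : measurable_fun setT tau.
Proof.
apply: measurable_fun_le => t; have [t0|t0] := leP 0 t.
  rewrite (_ : [set _ | _] = J t @^-1` [set cemetery q]).
    exact: (paths_measurable (regular_paths rJ)).
  by apply/seteqP; split => w /=; move/(regular_timeP rJ w t0).
rewrite (_ : [set _ | _] = set0)//; apply/seteqP; split => // w /= wt.
by have := regular_time_ge0 rJ w; rewrite leNgt (le_lt_trans wt).
Qed.

Lemma regular_absorption_time w : absorption_time J w = (tau w)%:E.
Proof.
rewrite -(ereal_inf_ray (regular_time_ge0 rJ w)) /absorption_time.
congr ereal_inf; congr (image _ _).
apply/seteqP; split => t /= [t0 H]; split => //.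
  by apply/(regular_timeP rJ w (ltW t0)).
by apply/(regular_timeP rJ w (ltW t0)).
Qed.

End regular_process_lemmas.

Lemma regular_phase_type_phase_type (R : realType) (mu : set R -> \bar R)
    (nu : set R -> R) :
  (forall A, measurable A -> mu A = (nu A)%:E) -> regular_phase_type nu ->
  phase_type mu.
Proof.
move=> munu [q [alpha [S [pa tS [d [Om [P [J [tau [rJ nuE]]]]]]]]]].
exists q, alpha, S; split => //; exists d, Om, P, J.
have mtau := regular_time_measurable rJ; split.
- apply: inf_markov_jump_process (regular_paths rJ) (regular_inf_markov rJ).
  exact: absorbing_generator.
- move=> j; rewrite -(regular_start rJ) prK//.
  exact: (paths_measurable (regular_paths rJ)).
- move=> A mA; rewrite munu// nuE// -prK; last first.
    by rewrite -[_ @^-1` _]setTI; exact: mtau.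
  congr (P _); apply/seteqP; split => w /=.
    by move=> Aw; exists (tau w) => //; exact: regular_absorption_time rJ w.
  by move=> [x Ax]; rewrite (regular_absorption_time rJ w) => -[->].
Qed.

(* Outside a null set the cemetery is never left and is reached in finite time;
   the process is replaced by the constant [cemetery q] on that set. *)
Section regularize.
Context (d : measure_display) (Omega : measurableType d) (R : realType).
Context (P : probability Omega R) (q : nat) (alpha : 'rV[R]_q) (S : 'M[R]_q).
Context (J : R -> Omega -> 'I_(q + 1)).
Hypothesis tS : transient_subintensity S.
Hypothesis pJ : jump_paths J.
Hypothesis iJ : inf_markov P (absorbing_intensity S) J.
Hypothesis sJ : forall j, pr P (J 0 @^-1` [set lshift 1 j]) = alpha 0 j.
Hypothesis aJ : P.-negligible [set w | absorption_time J w = +oo%E].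

Let c := cemetery q.

Let leave s t := [set w | [/\ 0 <= s, s <= t, J s w = c & J t w != c]].

(** The semigroup leaves [c] fixed, so moving from [c] to another state between two given times has
    probability 0. The conditions [0 <= s] and [s <= t] inside [leave] make it empty for all other
    pairs. *)
Let leave_negligible s t : P.-negligible (leave s t).
Proof.
have [s0|s0] := leP 0 s; last first.
  apply: negligibleS (negligible_set0 P) => w [s0'].
  by move: (lt_le_trans s0 s0'); rewrite ltxx.
have [st|st] := leP s t; last first.
  by apply: negligibleS (negligible_set0 P) => w [_]; rewrite leNgt st.
have [F LF H] := jump_markov
  (inf_markov_jump_process (absorbing_generator tS) pJ iJ).
pose B := J s @^-1` [set c].
have mB : measurable B by exact: paths_measurable.
have t0 : 0 <= t by exact: le_trans st.
pose X k := if k == c then set0 else B `&` J t @^-1` [set k].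
have mX k : measurable (X k).
  by rewrite /X; case: ifP => // _; apply: measurableI => //; exact: paths_measurable.
apply: (@negligibleS _ _ _ _ (\big[setU/set0]_(k < q + 1) X k)).
  move=> w [_ _ sc tc].
  rewrite (eq_bigl (fun k => k \in (predT : {pred 'I_(q + 1)})))// -bigcup_pred.
  by exists (J t w) => //; rewrite /X (negbTE tc).
apply: (big_ind (fun A => P.-negligible A)).
- exact: negligible_set0.
- by move=> A A'; exact: negligibleU.
move=> k _; exists (X k); split => //.
rewrite /X; case: ifPn => [_|kc]; first exact: measure0.
have [PB|PB] := eqVneq (P B) 0%E.
  apply/eqP; rewrite eq_le measure_ge0 andbT -PB le_measure ?inE//.
  by apply: measurableI => //; exact: paths_measurable.
have hT : history J `[0, s] setT by exact: historyT.
have := H s (t - s) setT c k s0; rewrite subr_ge0 st => /(_ isT hT).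
rewrite setTI lt0e PB measure_ge0 => /(_ isT).
rewrite (semigroup_absorbing LF (absorbing_cemetery S))// ?subr_ge0//.
rewrite eq_sym (negbTE kc) addrC subrK /condp [X in P X]setIC -/B.
move=> /eqP; rewrite mulf_eq0 => /orP[|].
  rewrite fine_eq0 ?fin_num_measure//; last first.
    by apply: measurableI => //; exact: paths_measurable.
  by move/eqP.
by rewrite invr_eq0 fine_eq0 ?fin_num_measure// (negbTE PB).
Qed.

Let bad := [set w | absorption_time J w = +oo%E] `|`
  \bigcup_n (if unpickle n is Some (r1, r2) then
    leave (ratr (r1 : rat)) (ratr (r2 : rat)) else set0).

Let bad_negligible : P.-negligible bad.
Proof.
apply: negligibleU => //; apply: negligible_bigcup => n.
case: unpickle => [[r1 r2]|]; [exact: leave_negligible|exact: negligible_set0].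
Qed.

(** Rational times suffice in [bad]: right continuity carries the cemetery from [s] to a rational in
    ]s, t[ and the state at [t] to a rational after [t], which puts [w] in some [leave]. *)
Let good_absorbing w s t : ~ bad w -> 0 <= s -> s < t -> J s w = c -> J t w = c.
Proof.
move=> nb s0 st sc; apply/eqP/negPn/negP => tc; apply: nb; right.
have t0 : 0 <= t by rewrite ltW// (le_lt_trans s0).
have /near_rightP[e1 e10 H1] := paths_right_continuous pJ w s0.
have /near_rightP[e2 e20 H2] := paths_right_continuous pJ w t0.
have [r1] : exists r : rat, ratr r \in `]s, (Num.min (s + e1) t)[.
  by apply: rat_in_itvoo; rewrite lt_min st ltrDl e10.
rewrite in_itv/= lt_min => /and3P[sr1 r1e r1t].
have [r2] : exists r : rat, ratr r \in `]t, (t + e2)[.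
  by apply: rat_in_itvoo; rewrite ltrDl.
rewrite in_itv/= => /andP[tr2 r2e].
exists (pickle (r1, r2)); first exact: I.
rewrite pickleK; split.
- by rewrite (le_trans s0)// ltW.
- by rewrite ltW// (lt_trans r1t).
- by rewrite H1 ?sr1.
- by rewrite H2 ?tr2.
Qed.

Let good_timeP w t : ~ bad w -> 0 <= t ->
  J t w = c <-> fine (absorption_time J w) <= t.
Proof.
move=> nb t0; set T := absorption_time J w.
have T0 : (0 <= T)%E.
  by apply: le_ereal_inf_tmp => _ [s [s0 _] <-]; rewrite lee_fin ltW.
have Tfin : T = (fine T)%:E.
  rewrite fineK// ge0_fin_numE// ltey; apply/eqP => Ty; apply: nb; by left.
split => [tc|Tt].
  apply/ler_addgt0Pr => e e0; rewrite -lee_fin -Tfin.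
  apply: ereal_inf_lbound; exists (t + e) => //; split.
    by rewrite ltr_wpDl.
  by apply: (@good_absorbing w t) => //; rewrite ltrDl.
(* Absorption occurs at some s < t + e / 2 and persists at [t + e / 2], where by right continuity
   the state is the same as at [t]. *)
have /near_rightP[e e0 H] := paths_right_continuous pJ w t0.
have te : t < t + e / 2 < t + e by apply/andP; split; lra.
rewrite -(H _ te).
have : (T < (t + e / 2)%:E)%E by rewrite Tfin lte_fin; lra.
rewrite /T /absorption_time => /ereal_inf_lt[_ [s [s0 sc] <-]].
by rewrite lte_fin => st; apply: good_absorbing st sc => //; exact: ltW.
Qed.

Lemma regularize : exists J' (tau' : Omega -> R),
  regular_process P alpha S J' tau' /\
  forall A, measurable (tau' @^-1` A) ->
    measurable ((fun w => fine (absorption_time J w)) @^-1` A) ->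
    pr P (tau' @^-1` A) =
    pr P ((fun w => fine (absorption_time J w)) @^-1` A).
Proof.
have [N [mN N0 badN]] := bad_negligible.
pose J' t w := if w \in N then c else J t w.
(* Time 0 is the one that fits the constant path [c] on [N]. *)
pose tau' w := if w \in N then 0 else fine (absorption_time J w).
have nN w : w \notin N -> ~ bad w by move=> + /badN; rewrite notin_setE.
have J'N : forall t k, J' t @^-1` [set k] `&` ~` N = J t @^-1` [set k] `&` ~` N.
  move=> t k; apply/seteqP; split => w /= [+ Nw]; rewrite /J' memNset//.
have mJ' t k : 0 <= t -> measurable (J' t @^-1` [set k]).
  move=> t0; rewrite -(setUIDK (_ @^-1` _) N) setDE J'N.
  apply: measurableU; last first.
    by apply: measurableI; [exact: paths_measurable|exact: measurableC].
  have [->|kc] := eqVneq k c.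
    rewrite (_ : _ `&` _ = N)//; apply/seteqP; split => [w []//|w Nw].
    by split => //=; rewrite /J' mem_set.
  rewrite (_ : _ `&` _ = set0)//; apply/seteqP; split => // w /= [].
  by rewrite /J' => + Nw; rewrite mem_set// => /eqP; rewrite eq_sym (negbTE kc).
have tr (X X' Y Y' : set Omega) : X `&` ~` N = X' `&` ~` N ->
    Y `&` ~` N = Y' `&` ~` N -> (X `&` Y) `&` ~` N = (X' `&` Y') `&` ~` N.
  by move=> XX' YY'; rewrite setIIl XX' YY' -setIIl.
exists J', tau'; split; last first.
  move=> A m1 m2; apply: pr_ae N0 _ _ _ => //.
  by apply/seteqP; split => w /= [+ Nw]; rewrite /tau' memNset.
have pJ' : jump_paths J'.
  split => //.
  - move=> w t t0; rewrite /J'; case: ifP => // _; last exact: paths_right_continuous.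
    by near=> s.
  - move=> w t t0; rewrite /J'.
    have [_|_] := boolP (w \in N); last exact: paths_left_limits.
    by exists c; near=> s.
split => //.
- move=> dl dl0; have [e e0 He] := iJ dl0; exists e => // h t A' j k he t0 hA'.
  have [h0 _] := andP he.
  have th0 : 0 <= t + h by rewrite addr_ge0.
  (* An event of the history of [J'] agrees outside [N] with one of the history of [J], to which the
     hypothesis applies. *)
  have [A hA AA'] : exists2 A, history J `[0, t] A &
      id @^-1` A' `&` ~` N = id @^-1` A `&` ~` N.
    apply: history_trace hA' => s i st; exists (J s @^-1` [set i]).
      by apply: history_state.
    exact: J'N.
  rewrite !preimage_id in AA'.
  have mA := history_itv_measurable pJ hA.
  have mA' := history_itv_measurable pJ' hA'.
  have := He h t A j k he t0 hA.
  have -> : pr P (A `&` J t @^-1` [set j]) = pr P (A' `&` J' t @^-1` [set j]).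
    apply: pr_ae mN N0 _ _ _; [apply: measurableI => //..|].
    - exact: paths_measurable.
    - exact: mJ'.
    - by apply: tr; rewrite ?AA' ?J'N.
  have -> : pr P (A `&` J t @^-1` [set j] `&` J (t + h) @^-1` [set k]) =
            pr P (A' `&` J' t @^-1` [set j] `&` J' (t + h) @^-1` [set k]).
    apply: pr_ae mN N0 _ _ _; [do 2?apply: measurableI => //..|].
    - exact: paths_measurable.
    - exact: paths_measurable.
    - exact: mJ'.
    - exact: mJ'.
    - by apply: (tr); [apply: (tr)|]; rewrite ?AA' ?J'N.
  exact.
- move=> j; rewrite -sJ; apply: pr_ae mN N0 _ _ _.
  + exact: mJ'.
  + exact: paths_measurable.
  + exact: J'N.
- move=> w; rewrite /tau'; case: ifPn => // _; apply: fine_ge0.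
  by apply: le_ereal_inf_tmp => _ [s [s0 _] <-]; rewrite lee_fin ltW.
- move=> w t t0; rewrite /J' /tau'; case: ifPn => [//|/nN nb].
  exact: good_timeP.
Unshelve. all: by end_near. Qed.

End regularize.

(** * Convolutions *)

Section product.
Context (d1 d2 : measure_display) (Om1 : measurableType d1)
  (Om2 : measurableType d2) (R : realType).
Context (P1 : probability Om1 R) (P2 : probability Om2 R).

Lemma measurable_pair_preimage (X : set (Om1 * Om2)) x :
  measurable X -> measurable (pair x @^-1` X).
Proof. by move=> mX; rewrite -xsectionE; exact: measurable_xsection. Qed.

Lemma pr_product_rect A B : measurable A -> measurable B ->
  pr (P1 \x P2)%E (A `*` B) = pr P1 A * pr P2 B.
Proof.
by move=> mA mB; rewrite /pr /= product_measure1E// fineM// fin_num_measure.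
Qed.

Let sec_measurable (X : set (Om1 * Om2)) : measurable X ->
  measurable_fun setT (fun x => pr P2 (pair x @^-1` X)).
Proof.
move=> mX; apply/measurable_EFinP.
rewrite (_ : EFin \o _ = P2 \o xsection X); first exact: measurable_fun_xsection.
by apply/funext => x /=; rewrite xsectionE -prK//; exact: measurable_pair_preimage.
Qed.

Let sec_integrable (X : set (Om1 * Om2)) : measurable X ->
  P1.-integrable setT (EFin \o (fun x => pr P2 (pair x @^-1` X))).
Proof.
move=> mX; apply: measurable_bounded_integrable => //.
- by rewrite /= -ge0_fin_numE// fin_num_measure.
- exact: sec_measurable.
- exists 1; split=> [|M M1 x _ /=]; first exact: num_real.
  rewrite ger0_norm ?pr_ge0// (le_trans _ (ltW M1))// pr_le1//.
  exact: measurable_pair_preimage.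
Qed.

Let pr_productE (X : set (Om1 * Om2)) : measurable X ->
  pr (P1 \x P2)%E X = \int[P1]_x pr P2 (pair x @^-1` X).
Proof.
move=> mX; rewrite /pr /product_measure1 /Rintegral; congr fine.
apply: eq_integral => x _ /=; rewrite xsectionE prK//.
exact: measurable_pair_preimage.
Qed.

(** Fubini: an estimate on every section integrates over the first coordinate. The event [Z] carries
    the error, so an estimate that is exact outside [Z] costs only the probability of [Z]. *)
Lemma pr_product_approx (X Y Z : set (Om1 * Om2)) (a b : R) :
  measurable X -> measurable Y -> measurable Z ->
  (forall x, `|pr P2 (pair x @^-1` X) - pr P2 (pair x @^-1` Y) * a| <=
             b * pr P2 (pair x @^-1` Z)) ->
  `|pr (P1 \x P2)%E X - pr (P1 \x P2)%E Y * a| <= b * pr (P1 \x P2)%E Z.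
Proof.
move=> mX mY mZ H; rewrite !pr_productE// -RintegralZr//; last exact: sec_integrable.
rewrite -RintegralZl//; last exact: sec_integrable.
have iYa : P1.-integrable setT
    (EFin \o (fun x => pr P2 (pair x @^-1` Y) * a)).
  rewrite (_ : EFin \o _ = fun x => ((EFin \o (fun x => pr P2 (pair x @^-1` Y))) x * a%:E)%E).
    by apply: integrableZr => //; exact: sec_integrable.
  by apply/funext => x /=; rewrite EFinM.
have ibZ : P1.-integrable setT
    (EFin \o (fun x => b * pr P2 (pair x @^-1` Z))).
  rewrite (_ : EFin \o _ = fun x => (b%:E * (EFin \o (fun x => pr P2 (pair x @^-1` Z))) x)%E).
    by apply: integrableZl => //; exact: sec_integrable.
  by apply/funext => x /=; rewrite EFinM.
rewrite -RintegralB//; last exact: sec_integrable.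
have iD : P1.-integrable setT (EFin \o
    (fun x => pr P2 (pair x @^-1` X) - pr P2 (pair x @^-1` Y) * a)).
  pose f x := pr P2 (pair x @^-1` X); pose g x := pr P2 (pair x @^-1` Y) * a.
  rewrite (_ : EFin \o _ = ((EFin \o f) \- (EFin \o g))%E).
    by apply: integrableB => //; exact: sec_integrable.
  by apply/funext => x /=; rewrite EFinB.
apply: le_trans (le_normr_Rintegral _ iD) _ => //.
by apply: le_Rintegral => //; exact: (integrable_norm iD).
Qed.

End product.

(** By right continuity [J s] is the eventual value of [J] at the grid points [a N s], and at each
    level the discretized event is a countable union of rectangles. This is what allows evaluating
    the second process at the random time [t - tau1]. *)
Lemma paths_jointly_measurable (d : measure_display) (Omega : measurableType d)
    (R : realType) (n : nat) (J : R -> Omega -> 'I_n) (k : 'I_n) :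
  jump_paths J ->
  measurable [set sw : R * Omega | 0 <= sw.1 /\ J sw.1 sw.2 = k].
Proof.
move=> pJ.
(* The successor makes [a N s] strictly larger than [s], as right neighbourhoods exclude [s]
   itself. *)
pose a (N : nat) (s : R) : R := (Num.truncn (s * N.+1%:R)).+1%:R / N.+1%:R.
pose C N := [set sw : R * Omega | 0 <= sw.1 /\ J (a N sw.1) sw.2 = k].
have N0 N : 0 < N.+1%:R :> R by rewrite ltr0n.
have aP N s : 0 <= s -> s < a N s <= s + N.+1%:R^-1.
  move=> s0; have sN0 : 0 <= s * N.+1%:R by rewrite mulr_ge0.
  have /andP[t1 t2] := truncn_itv sN0.
  apply/andP; split; first by rewrite /a ltr_pdivlMr.
  rewrite /a ler_pdivrMr// mulrDl mulVf ?lt0r_neq0// -natr1.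
  by rewrite lerD2r.
have mC N : measurable (C N).
  rewrite (_ : C N = \bigcup_m
    ([set s | m%:R / N.+1%:R <= s < m.+1%:R / N.+1%:R] `*`
     (J (m.+1%:R / N.+1%:R) @^-1` [set k]))).
    apply: bigcupT_measurable => m; apply: measurableX; last first.
      by apply: paths_measurable => //; rewrite divr_ge0.
    by rewrite (_ : [set _ | _] = `[m%:R / N.+1%:R, m.+1%:R / N.+1%:R[%classic).
  apply/seteqP; split => [[s w] /= [s0 Jk]|[s w] [m _ [/= /andP[ms sm] Jk]]].
    exists (Num.truncn (s * N.+1%:R)) => //; split => //=.
    have sN0 : 0 <= s * N.+1%:R by rewrite mulr_ge0.
    have /andP[t1 t2] := truncn_itv sN0.
    by rewrite ler_pdivrMr// t1/= ltr_pdivlMr.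
  have s0 : 0 <= s by rewrite (le_trans _ ms)// divr_ge0.
  split => //=; rewrite /a (_ : Num.truncn _ = m)//.
  by apply: truncn_def; rewrite -ler_pdivrMr// ms/= -ltr_pdivlMr.
rewrite (_ : [set _ | _] = \bigcup_N \bigcap_m C (N + m)%N).
  by apply: bigcupT_measurable => N; apply: bigcapT_measurable => m.
have near_a s e : 0 < e -> 0 <= s ->
    exists N, forall m, s < a (N + m)%N s < s + e.
  move=> e0 s0; exists (Num.truncn e^-1) => m.
  have /andP[-> h] := aP (Num.truncn e^-1 + m)%N s s0; rewrite (le_lt_trans h)//.
  rewrite ltrD2l -[ltRHS]invrK ltf_pV2 ?posrE ?invr_gt0//.
  rewrite (lt_le_trans (truncnS_gt _))// ler_nat ltnS leq_addr//.
apply/seteqP; split => [[s w] /= [s0 Jk]|[s w] [N _ H]].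
  have /near_rightP[e e0 He] := paths_right_continuous pJ w s0.
  have [N HN] := near_a s e e0 s0.
  by exists N => // m _; split => //=; rewrite He.
have [/= s0 _] := H 0%N I; split => //=.
have /near_rightP[e e0 He] := paths_right_continuous pJ w s0.
have [M HM] := near_a s e e0 s0.
have [_ /= <-] := H M I; rewrite He// addnC; exact: HM.
Qed.

(** Serves for an absorption inside a step of length h: the second process has then run for less
    than h, and its law is still the initial one up to [M * h]. *)
Lemma inf_markov_start (d : measure_display) (Omega : measurableType d)
    (R : realType) (P : probability Omega R) (n : nat) (L : 'M[R]_n)
    (J : R -> Omega -> 'I_n) :
  jump_paths J -> inf_markov P L J ->
  exists2 M : R, 0 < M & exists2 e : R, 0 < e & forall h k, 0 <= h < e ->
    `|pr P (J h @^-1` [set k]) - pr P (J 0 @^-1` [set k])| <= M * h.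
Proof.
move=> pJ iJ; have [e e0 He] := iJ 1 ltr01.
(* In each summand, 1 is the error allowed by [He] and [|L j k|] bounds the first-order term; the
   leading 1 makes [M] positive. *)
pose M : R := 1 + \sum_j \sum_k (1 + `|L j k|).
have M1 k : \sum_j (1 + `|L j k|) <= M.
  rewrite /M [X in _ <= _ + X]exchange_big/= [X in _ <= _ + X](bigD1 k)//= addrCA.
  by rewrite lerDl addr_ge0// sumr_ge0// => i _; rewrite sumr_ge0.
have M0 : 0 < M.
  by rewrite /M ltr_pwDl// sumr_ge0// => i _; rewrite sumr_ge0.
exists M => //; exists e => // h k he; have [h0 _] := andP he.
have mJ t i : 0 <= t -> measurable (J t @^-1` [set i]).
  by move=> t0; exact: paths_measurable.
rewrite (pr_fibers (K := J 0) P _ (mJ h k h0)); last by move=> i; exact: mJ.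
have -> : pr P (J 0 @^-1` [set k]) =
    \sum_j pr P (J 0 @^-1` [set j]) * (j == k)%:R.
  rewrite (bigD1 k)//= eqxx mulr1 big1 ?addr0// => j jk.
  by rewrite (negbTE jk) mulr0.
rewrite -sumrB (le_trans (ler_norm_sum _ _ _))//.
apply: (@le_trans _ _ (\sum_j (1 + `|L j k|) * h)); last first.
  by rewrite -mulr_suml ler_wpM2r.
apply: ler_sum => j _.
have hT : history J `[0, 0] setT by exact: historyT.
have := He h 0 setT j k he (lexx _) hT.
rewrite setTI add0r setIC mul1r; set a := pr P _; set b := pr P _ => H.
have b01 : 0 <= b <= 1 by rewrite pr_ge0 pr_le1//; exact: mJ.
rewrite (_ : _ - _ = (a - b * ((j == k)%:R + h * L j k)) + b * (h * L j k)); last by ring.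
rewrite (le_trans (ler_normD _ _))// mulrDl mul1r lerD//.
rewrite !normrM (ger0_norm h0) mulrCA mulrC ler_wpM2r//.
by case/andP: b01 => b0 b1; rewrite ger0_norm// ler_piMl.
Qed.

Lemma regular_start_cemetery (d : measure_display) (Omega : measurableType d)
    (R : realType) (P : probability Omega R) (q : nat) (alpha : 'rV[R]_q)
    (J : R -> Omega -> 'I_(q + 1)) :
  jump_paths J -> probability_vector alpha ->
  (forall j, pr P (J 0 @^-1` [set lshift 1 j]) = alpha 0 j) ->
  pr P (J 0 @^-1` [set cemetery q]) = 0.
Proof.
move=> pJ [_ sa] sJ.
have := @pr_fibers _ _ _ P _ (J 0) setT (fun k => paths_measurable pJ k (lexx _)).
move=> /(_ measurableT); rewrite prT big_split_ord/= big_ord1 setTI -/(cemetery q).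
under eq_bigr do rewrite setTI sJ.
by rewrite sa => /eqP; rewrite -subr_eq0 opprD addrA subrr add0r oppr_eq0 => /eqP.
Qed.

Section embeddings.
Context (q1 q2 : nat).

(** Both embeddings send the cemetery of their block to the common one, where their ranges meet.
    Concatenations and mixtures share them. *)
Definition emb1 (k : 'I_(q1 + 1)) : 'I_(q1 + q2 + 1) :=
  match fintype.split k with
  | inl a => lshift 1 (lshift q2 a)
  | inr _ => cemetery (q1 + q2)
  end.

Definition emb2 (k : 'I_(q2 + 1)) : 'I_(q1 + q2 + 1) :=
  match fintype.split k with
  | inl b => lshift 1 (rshift q1 b)
  | inr _ => cemetery (q1 + q2)
  end.

Lemma emb1_lshift a : emb1 (lshift 1 a) = lshift 1 (lshift q2 a).
Proof. by rewrite /emb1 (unsplitK (inl a)). Qed.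

Lemma emb1_cemetery : emb1 (cemetery q1) = cemetery (q1 + q2).
Proof. by rewrite /emb1 (unsplitK (inr ord0)). Qed.

Lemma emb2_lshift b : emb2 (lshift 1 b) = lshift 1 (rshift q1 b).
Proof. by rewrite /emb2 (unsplitK (inl b)). Qed.

Lemma emb2_cemetery : emb2 (cemetery q2) = cemetery (q1 + q2).
Proof. by rewrite /emb2 (unsplitK (inr ord0)). Qed.

Lemma emb1_inj : injective emb1.
Proof.
move=> j k; have [->|[a ->]] := ord_cemetery j;
  have [->|[b ->]] := ord_cemetery k; rewrite ?emb1_lshift ?emb1_cemetery//.
- by move/eqP; rewrite eq_sym (negbTE (lshift_neq_cemetery _)).
- by move/eqP; rewrite (negbTE (lshift_neq_cemetery _)).
- by move/lshift_inj/lshift_inj->.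
Qed.

Lemma emb2_inj : injective emb2.
Proof.
move=> j k; have [->|[a ->]] := ord_cemetery j;
  have [->|[b ->]] := ord_cemetery k; rewrite ?emb2_lshift ?emb2_cemetery//.
- by move/eqP; rewrite eq_sym (negbTE (lshift_neq_cemetery _)).
- by move/eqP; rewrite (negbTE (lshift_neq_cemetery _)).
- by move/lshift_inj/rshift_inj->.
Qed.

Lemma emb1_neq_emb2 a k : emb1 (lshift 1 a) != emb2 k.
Proof.
rewrite emb1_lshift; have [->|[b ->]] := ord_cemetery k.
  by rewrite emb2_cemetery lshift_neq_cemetery.
by rewrite emb2_lshift (inj_eq (@lshift_inj _ _)) eq_lrshift.
Qed.

Lemma emb_cases (k : 'I_(q1 + q2 + 1)) :
  (exists a, k = emb1 (lshift 1 a)) \/ (exists b, k = emb2 b).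
Proof.
have [->|[i ->]] := ord_cemetery k.
  by right; exists (cemetery q2); rewrite emb2_cemetery.
case: (split_ordP i) => j ->.
  by left; exists j; rewrite emb1_lshift.
by right; exists (lshift 1 j); rewrite emb2_lshift.
Qed.

End embeddings.

(* Upon absorption of the first block, the second one is entered with
   distribution [alpha]. *)
Definition concat_intensity (R : realType) (q1 q2 : nat) (S1 : 'M[R]_q1)
    (alpha : 'rV[R]_q2) (S2 : 'M[R]_q2) : 'M[R]_(q1 + q2) :=
  block_mx S1 (exit_rates S1 *m alpha) 0 S2.

Section concat_intensity.
Context (R : realType) (q1 q2 : nat) (S1 : 'M[R]_q1) (alpha : 'rV[R]_q2).
Context (S2 : 'M[R]_q2).
Hypotheses (tS1 : transient_subintensity S1) (tS2 : transient_subintensity S2).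
Hypothesis palpha : probability_vector alpha.
Let S := concat_intensity S1 alpha S2.

Lemma exit_ratesE (q : nat) (T : 'M[R]_q) a :
  exit_rates T a 0 = - \sum_k T a k.
Proof.
by rewrite !mxE; congr (- _); apply: eq_bigr => k _; rewrite mxE mulr1.
Qed.

Let ul a c : S (lshift _ a) (lshift _ c) = S1 a c.
Proof. by rewrite /S /concat_intensity block_mxEul. Qed.

Let ur a b : S (lshift _ a) (rshift _ b) = (- \sum_k S1 a k) * alpha 0 b.
Proof.
by rewrite /S /concat_intensity block_mxEur mxE big_ord1 exit_ratesE.
Qed.

Let dl b c : S (rshift _ b) (lshift _ c) = 0.
Proof. by rewrite /S /concat_intensity block_mxEdl mxE. Qed.

Let dr b c : S (rshift _ b) (rshift _ c) = S2 b c.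
Proof. by rewrite /S /concat_intensity block_mxEdr. Qed.

Let row1 a : \sum_k S (lshift _ a) k = 0.
Proof.
rewrite big_split_ord/=; under eq_bigr do rewrite ul.
under [X in _ + X]eq_bigr do rewrite ur.
by rewrite -mulr_sumr (proj2 palpha) mulr1 addrN.
Qed.

Let row2 b : \sum_k S (rshift _ b) k = \sum_k S2 b k.
Proof.
rewrite big_split_ord/= big1 ?add0r; last by move=> c _; rewrite dl.
by apply: eq_bigr => c _; rewrite dr.
Qed.

Lemma concat_transient : transient_subintensity S.
Proof.
split.
- move=> j k; case: (split_ordP j) => a ->; case: (split_ordP k) => b -> ab.
  + rewrite ul; apply: (subintensity_offdiag tS1).
    by rewrite (inj_eq (@lshift_inj _ _)) in ab.
  + rewrite ur mulr_ge0 ?(proj1 palpha)// oppr_ge0.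
    exact: (subintensity_rowsum tS1).
  + by rewrite dl.
  + rewrite dr; apply: (subintensity_offdiag tS2).
    by rewrite (inj_eq (@rshift_inj _ _)) in ab.
- move=> j; case: (split_ordP j) => a ->.
  + by rewrite ul (subintensity_diag tS1).
  + by rewrite dr (subintensity_diag tS2).
- move=> j; case: (split_ordP j) => a ->.
  + by rewrite row1.
  + by rewrite row2 (subintensity_rowsum tS2).
- rewrite unitmxE /S /concat_intensity det_ublock unitrM -!unitmxE.
  by rewrite (subintensity_transient tS1) (subintensity_transient tS2).
Qed.

Lemma concat11 a c : absorbing_intensity S (emb1 q2 (lshift 1 a)) (emb1 q2 (lshift 1 c)) =
  absorbing_intensity S1 (lshift 1 a) (lshift 1 c).
Proof. by rewrite !emb1_lshift !absorbing_transient ul. Qed.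

(** The rows of the first block sum to 0 since [alpha] has mass 1, so the cemetery is never entered
    directly from it. Extending [alpha] by 0 to the cemetery, as [s] does, lets one formula cover
    every [k]. *)
Lemma concat12 a k (s : 'I_(q2 + 1) -> R) :
  (forall b, s (lshift 1 b) = alpha 0 b) -> s (cemetery q2) = 0 ->
  absorbing_intensity S (emb1 q2 (lshift 1 a)) (emb2 q1 k) =
  absorbing_intensity S1 (lshift 1 a) (cemetery q1) * s k.
Proof.
move=> sb sc; rewrite emb1_lshift absorbing_exit.
have [->|[b ->]] := ord_cemetery k.
  by rewrite emb2_cemetery absorbing_exit row1 sc mulr0 oppr0.
by rewrite emb2_lshift absorbing_transient ur sb.
Qed.

Lemma concat21 k a :
  absorbing_intensity S (emb2 q1 k) (emb1 q2 (lshift 1 a)) = 0.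
Proof.
have [->|[b ->]] := ord_cemetery k.
  by rewrite emb2_cemetery absorbing_cemetery.
by rewrite emb2_lshift emb1_lshift absorbing_transient dl.
Qed.

Lemma concat22 j k : absorbing_intensity S (emb2 q1 j) (emb2 q1 k) =
  absorbing_intensity S2 j k.
Proof.
have [->|[b ->]] := ord_cemetery j.
  by rewrite emb2_cemetery !absorbing_cemetery.
have [->|[c ->]] := ord_cemetery k; rewrite emb2_lshift.
  by rewrite emb2_cemetery !absorbing_exit row2.
by rewrite emb2_lshift !absorbing_transient dr.
Qed.

End concat_intensity.

Section concat.
Context (d1 d2 : measure_display) (Om1 : measurableType d1)
  (Om2 : measurableType d2) (R : realType).
Context (P1 : probability Om1 R) (P2 : probability Om2 R).
Context (q1 q2 : nat) (alpha1 : 'rV[R]_q1) (alpha2 : 'rV[R]_q2).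
Context (S1 : 'M[R]_q1) (S2 : 'M[R]_q2).
Context (J1 : R -> Om1 -> 'I_(q1 + 1)) (J2 : R -> Om2 -> 'I_(q2 + 1)).
Context (tau1 : Om1 -> R) (tau2 : Om2 -> R).
Hypotheses (tS1 : transient_subintensity S1) (tS2 : transient_subintensity S2).
Hypotheses (pa1 : probability_vector alpha1) (pa2 : probability_vector alpha2).
Hypothesis rJ1 : regular_process P1 alpha1 S1 J1 tau1.
Hypothesis rJ2 : regular_process P2 alpha2 S2 J2 tau2.

Let K t (w : Om1 * Om2) : 'I_(q1 + q2 + 1) :=
  if t < tau1 w.1 then emb1 q2 (J1 t w.1)
  else emb2 q1 (J2 (t - tau1 w.1) w.2).

Let pJ1 := regular_paths rJ1.
Let pJ2 := regular_paths rJ2.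
Let P := (P1 \x P2)%E : probability (Om1 * Om2)%type R.
Let L := absorbing_intensity (concat_intensity S1 alpha2 S2).

Let J1_lt_tau t w : 0 <= t -> t < tau1 w -> exists a, J1 t w = lshift 1 a.
Proof.
move=> t0 tt; have [Jc|//] := ord_cemetery (J1 t w).
by move: tt; rewrite ltNge (proj1 (regular_timeP rJ1 w t0) Jc).
Qed.

Let lt_tau_J1 t w a : 0 <= t -> J1 t w = lshift 1 a -> t < tau1 w.
Proof.
move=> t0 Ja; rewrite ltNge; apply/negP => /(regular_timeP rJ1 w t0).
by rewrite Ja => /eqP; rewrite (negbTE (lshift_neq_cemetery _)).
Qed.

Let K1E t a : 0 <= t ->
  K t @^-1` [set emb1 q2 (lshift 1 a)] = (J1 t @^-1` [set lshift 1 a]) `*` setT.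
Proof.
move=> t0; apply/seteqP; split => -[x y] /=; rewrite /K/=.
  case: ifP => [_ /emb1_inj//|_ /eqP].
  by rewrite eq_sym (negbTE (emb1_neq_emb2 _ _)).
by move=> [Ja _]; rewrite (lt_tau_J1 t0 Ja) Ja.
Qed.

Let K2E t b : 0 <= t -> K t @^-1` [set emb2 q1 b] =
  [set w | 0 <= t - tau1 w.1 /\ J2 (t - tau1 w.1) w.2 = b].
Proof.
move=> t0; apply/seteqP; split => -[x y] /=; rewrite /K/= subr_ge0.
  case: ltP => [tt|_ /emb2_inj//].
  have [a ->] := J1_lt_tau t0 tt.
  by move/eqP; rewrite (negbTE (emb1_neq_emb2 _ _)).
by case: ltP => [_ []//|_ [_ ->]].
Qed.

Let joint_measurable (t : R) b :
  measurable [set w : Om1 * Om2 | 0 <= t - tau1 w.1 /\ J2 (t - tau1 w.1) w.2 = b].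
Proof.
pose g (w : Om1 * Om2) : R * Om2 := (t - tau1 w.1, w.2).
have mg : measurable_fun setT g.
  apply: measurable_fun_pair; last exact: measurable_snd.
  apply: measurable_funB; first exact: measurable_cst.
  exact: measurableT_comp (regular_time_measurable rJ1) measurable_fst.
have := mg measurableT _ (paths_jointly_measurable b pJ2).
by rewrite setTI.
Qed.

Let mK t k : 0 <= t -> measurable (K t @^-1` [set k]).
Proof.
move=> t0; have [[a ->]|[b ->]] := emb_cases k.
  by rewrite K1E//; apply: measurableX => //; exact: paths_measurable.
by rewrite K2E//; exact: joint_measurable.
Qed.

Let pK : jump_paths K.
Proof.
split => //.
- move=> [x y] t t0; apply/near_rightP.
  have [tt|tt] := ltP t (tau1 x).
    have /near_rightP[e e0 He] := paths_right_continuous pJ1 x t0.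
    exists (Num.min e (tau1 x - t)); first by rewrite lt_min e0 subr_gt0.
    move=> s /andP[ts]; rewrite -ltrBlDl lt_min => /andP[se sx].
    have {}sx : s < tau1 x by lra.
    by rewrite /K/= sx tt He// ts/=; lra.
  have tt0 : 0 <= t - tau1 x by rewrite subr_ge0.
  have /near_rightP[e e0 He] := paths_right_continuous pJ2 y tt0.
  exists e => // s /andP[ts se].
  have sx : tau1 x <= s by rewrite (le_trans tt)// ltW.
  rewrite /K/= ltNge sx ltNge tt/= He//; apply/andP; split; lra.
- move=> [x y] t t0; have [tt|tt] := leP t (tau1 x).
    have [k /near_leftP[e e0 He]] := paths_left_limits pJ1 x t0.
    exists (emb1 q2 k); apply/near_leftP; exists e => // s /andP[es st].
    by rewrite /K/= (lt_le_trans st tt) He// es.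
  have tt0 : 0 < t - tau1 x by rewrite subr_gt0.
  have [k /near_leftP[e e0 He]] := paths_left_limits pJ2 y tt0.
  exists (emb2 q1 k); apply/near_leftP.
  exists (Num.min e (t - tau1 x)); first by rewrite lt_min e0.
  move=> s /andP[es st]; have : t - s < Num.min e (t - tau1 x) by lra.
  rewrite lt_min => /andP[h1 h2].
  have sx : tau1 x <= s by lra.
  by rewrite /K/= ltNge sx/= He//; apply/andP; split; lra.
Qed.

(* Before the first absorption, the history of [K] is that of [J1]. *)
Let trace1 t A a : 0 <= t -> history K `[0, t] A ->
  exists2 B, history J1 `[0, t] B & A `&` K t @^-1` [set emb1 q2 (lshift 1 a)] =
    (B `&` J1 t @^-1` [set lshift 1 a]) `*` setT.
Proof.
move=> t0 hA; rewrite K1E//; set E := _ `*` _.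
have [B hB AB] : exists2 B, history J1 `[0, t] B &
    id @^-1` A `&` E = fst @^-1` B `&` E.
  apply: history_trace hA => s k /= st; have [s0 s_t] : 0 <= s /\ s <= t.
    by move: st; rewrite in_itv/= => /andP[].
  have Es w : E w -> s < tau1 w.1.
    by case: w => x y [/= Ja _]; rewrite (le_lt_trans s_t)// (lt_tau_J1 t0 Ja).
  have [[c ->]|[b ->]] := emb_cases k.
    exists (J1 s @^-1` [set lshift 1 c]); first by apply: history_state.
    by rewrite preimage_id K1E//; apply/seteqP; split => -[x y] /= [] // [].
  exists set0; first exact: sigma_algebra0.
  rewrite preimage_set0 set0I; apply/seteqP; split => // w [Kw Ew].
  have [c Jc] := J1_lt_tau s0 (Es _ Ew).
  move: Kw; rewrite /= /K (Es _ Ew) Jc => /eqP.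
  by rewrite (negbTE (emb1_neq_emb2 _ _)).
exists B => //; rewrite preimage_id in AB; rewrite AB.
by apply/seteqP; split => -[x y] /=; rewrite /E/= => -[]; tauto.
Qed.

(* After the first absorption at time [tau1 x], the history of [K] with the
   first coordinate frozen to [x] is that of [J2] up to time [t - tau1 x]. *)
Let trace2 t A x : tau1 x <= t -> history K `[0, t] A ->
  history J2 `[0, t - tau1 x] (pair x @^-1` A).
Proof.
move=> xt hA.
have [B hB AB] : exists2 B, history J2 `[0, t - tau1 x] B &
    pair x @^-1` A `&` setT = id @^-1` B `&` setT.
  apply: history_trace hA => s k /= st; have [s0 s_t] : 0 <= s /\ s <= t.
    by move: st; rewrite in_itv/= => /andP[].
  have [sx|xs] := ltP s (tau1 x).
    have [->|Jk] := eqVneq k (emb1 q2 (J1 s x)).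
      exists setT; first exact: historyT.
      by rewrite setIT; apply/seteqP; split => // y _ /=; rewrite /K/= sx.
    exists set0; first exact: sigma_algebra0.
    rewrite !setIT preimage_set0; apply/seteqP; split => // y /=; rewrite /K/= sx => Jk'.
    by move: Jk; rewrite Jk' eqxx.
  have [[c ->]|[b ->]] := emb_cases k.
    exists set0; first exact: sigma_algebra0.
    rewrite !setIT preimage_set0; apply/seteqP; split => // y /=; rewrite /K/= ltNge xs/=.
    by move/eqP; rewrite eq_sym (negbTE (emb1_neq_emb2 _ _)).
  exists (J2 (s - tau1 x) @^-1` [set b]).
    by apply: history_state; rewrite /= in_itv/= subr_ge0 xs lerD2r.
  rewrite !setIT; apply/seteqP; split => y /=; rewrite /K/= ltNge xs/=.
    by move/emb2_inj.
  by move=> ->.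
by move: AB; rewrite !setIT preimage_id => ->.
Qed.

(** Cases by the blocks occupied at [t] and [t + h]. Within a block the estimate is that of the
    corresponding process, at the shifted time [t - tau1 x] for the second one; a return to the
    first block is impossible. A crossing is an absorption of the first process within the step,
    with rate [x1 a], after which the second process has law [s] up to O(h); this correction is
    charged only on an event of probability O(h). *)
Lemma concat_inf_markov : inf_markov P L K.
Proof.
move=> dl dl0.
have [M M0 [e1 e10 H1]] := inf_markov_start pJ2 (regular_inf_markov rJ2).
pose s k := pr P2 (J2 0 @^-1` [set k]).
have s01 k : 0 <= s k <= 1.
  by rewrite pr_ge0 pr_le1//; exact: paths_measurable.
have sc : s (cemetery q2) = 0.
  exact: regular_start_cemetery pJ2 pa2 (regular_start rJ2).
have sb b : s (lshift 1 b) = alpha2 0 b by exact: (regular_start rJ2).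
pose x1 a := absorbing_intensity S1 (lshift 1 a) (cemetery q1).
have x10 a : 0 <= x1 a.
  by rewrite /x1 absorbing_exit oppr_ge0; exact: (subintensity_rowsum tS1).
(* [C * h] will bound the probability that the first process is absorbed during the step: its rate
   plus the error [dl / 2] of its estimate. *)
pose C := \sum_a x1 a + dl.
have xC a : x1 a + dl / 2 <= C.
  rewrite /C (bigD1 a)//= -addrA lerD2l.
  have : 0 <= \sum_(i < q1 | i != a) x1 i by rewrite sumr_ge0.
  by lra.
have C0 : 0 < C by rewrite /C ltr_wpDl// sumr_ge0.
have dl2 : 0 < dl / 2 by rewrite divr_gt0.
have [e2 e20 H2] := regular_inf_markov rJ1 dl2.
have [e3 e30 H3] := regular_inf_markov rJ2 dl0.
(* The last bound makes M h C h at most [dl / 2 * h]; the other half of the allowed error goes to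
   the first process. *)
exists (Num.min e1 (Num.min e2 (Num.min e3 (dl / 2 / (M * C))))).
  by rewrite !lt_min e10 e20 e30/= divr_gt0// mulr_gt0.
move=> h t A j k /andP[h0]; rewrite !lt_min => /and4P[he1 he2 he3 he4] t0 hA.
have th0 : 0 <= t + h by rewrite addr_ge0.
have mA := history_itv_measurable pK hA.
have [[a ->]|[b ->]] := emb_cases j.
- have [B hB ABa] := @trace1 t A a t0 hA.
  have mB := history_itv_measurable pJ1 hB.
  have mBa : measurable (B `&` J1 t @^-1` [set lshift 1 a]).
    by apply: measurableI => //; exact: paths_measurable.
  rewrite ABa.
  have -> : pr P ((B `&` J1 t @^-1` [set lshift 1 a]) `*` setT) =
      pr P1 (B `&` J1 t @^-1` [set lshift 1 a]).
    by rewrite pr_product_rect// prT mulr1.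
  have [[c ->]|[b ->]] := emb_cases k.
    rewrite K1E// -setXI setIT pr_product_rect ?prT ?mulr1//; last first.
      by apply: measurableI => //; exact: paths_measurable.
    rewrite /L concat11 (inj_eq (@emb1_inj _ _)).
    apply: (le_trans (H2 h t B _ _ _ t0 hB)); first by rewrite h0.
    by rewrite ler_wpM2r//; lra.
  rewrite (negbTE (emb1_neq_emb2 _ _)) add0r /L.
  rewrite (@concat12 _ _ _ S1 alpha2 S2 pa2 a b s sb sc) -/(x1 a).
  pose B' := B `&` J1 t @^-1` [set lshift 1 a] `&` J1 (t + h) @^-1` [set cemetery q1].
  have mB' : measurable B' by apply: measurableI => //; exact: paths_measurable.
  set X := _ `&` _.
  have mX : measurable X.
    by apply: measurableI; [exact: measurableX|exact: mK].
  (* Outside [B'] the sections of both events are empty; for [x] in [B'] the section of [X] says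
     that the second process is in [b] at time [t + h - tau1 x], which is less than [h]. *)
  have XB' : `|pr P X - pr P (B' `*` setT) * s b| <= M * h * pr P (B' `*` setT).
    apply: pr_product_approx => //; [exact: measurableX|exact: measurableX|].
    move=> x; have [B'x|nB'x] := pselect (B' x); last first.
      rewrite (_ : _ @^-1` X = set0); last first.
        apply/seteqP; split => // y [[Bx _]]; rewrite K2E//= => -[xt _].
        apply: nB'x; split => //=.
        by apply/(regular_timeP rJ1 x th0); rewrite -subr_ge0.
      rewrite (_ : _ @^-1` _ = set0); last first.
        by apply/seteqP; split => // y [].
      by rewrite pr0 mul0r subrr normr0 mulr0.
    have xt : tau1 x <= t + h by apply/(regular_timeP rJ1 x th0); case: B'x.
    have tx : t < tau1 x by case: B'x => -[_ /= Ja] _; exact: lt_tau_J1 Ja.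
    rewrite (_ : pair x @^-1` X = J2 (t + h - tau1 x) @^-1` [set b]); last first.
      rewrite /X K2E//; apply/seteqP; split => y /=; first by move=> [_ []].
      by rewrite subr_ge0 xt => ->; split => //; split => //; case: B'x.
    rewrite (_ : pair x @^-1` _ = setT); last first.
      by apply/seteqP; split => // y _; split.
    rewrite prT mul1r mulr1.
    apply: (le_trans (H1 _ b _)); first by apply/andP; split; lra.
    by rewrite ler_wpM2l ?(ltW M0)//; lra.
  have PB' : pr P (B' `*` setT) = pr P1 B' by rewrite pr_product_rect// prT mulr1.
  rewrite PB' in XB'.
  have := H2 h t B (lshift 1 a) (cemetery q1).
  rewrite h0 he2 => /(_ isT t0 hB).
  rewrite (negbTE (lshift_neq_cemetery _)) add0r -/B' -/(x1 a).
  set z := pr P1 (_ `&` _); set z' := pr P1 B' => zz'.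
  have z01 : 0 <= z <= 1 by rewrite pr_ge0 pr_le1.
  have z'0 : 0 <= z' by exact: pr_ge0.
  rewrite -/z' in XB'.
  have z'le : z' <= C * h.
    move: zz'; rewrite ler_distl => /andP[_ zz'].
    have : z * (h * x1 a) <= h * x1 a.
      by case/andP: z01 => z0 z1; rewrite ler_piMl// mulr_ge0.
    have := xC a; have : (x1 a + dl / 2) * h <= C * h by rewrite ler_wpM2r.
    lra.
  rewrite (_ : _ - _ = (pr P X - z' * s b) + (z' - z * (h * x1 a)) * s b); last by ring.
  apply: (le_trans (ler_normD _ _)).
  have n1 : `|pr P X - z' * s b| <= dl / 2 * h.
    apply: (le_trans XB'); apply: (@le_trans _ _ (M * h * (C * h))).
      by rewrite ler_wpM2l// mulr_ge0// ltW.
    rewrite mulrA ler_wpM2r// mulrAC -ler_pdivlMl ?mulr_gt0// mulrC.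
    by rewrite ltW// (mulrC _ (dl / 2)).
  have n2 : `|(z' - z * (h * x1 a)) * s b| <= dl / 2 * h.
    have /andP[sb0 sb1] := s01 b.
    by rewrite normrM (ger0_norm sb0) (le_trans _ zz')// ler_piMr.
  by apply: (le_trans (lerD n1 n2)); rewrite -mulrDl -splitr.
- have [[c ->]|[b' ->]] := emb_cases k.
    rewrite /L (concat21 S1 alpha2 S2) eq_sym (negbTE (emb1_neq_emb2 _ _)).
    rewrite mulr0 addr0 mulr0 subr0 (_ : _ `&` _ = set0).
      by rewrite pr0 normr0 mulr_ge0// ltW.
    rewrite K1E// K2E//; apply/seteqP; split => // -[x y] [[_ /= [xt _]] [Jc _]].
    have := lt_tau_J1 th0 Jc; rewrite ltNge => /negP; apply.
    by rewrite (@le_trans _ _ t) ?lerDl// -subr_ge0.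
  rewrite /L (concat22 S1 alpha2 S2) (inj_eq (@emb2_inj _ _)).
  set Y := A `&` _; set X := Y `&` _.
  have mY : measurable Y by apply: measurableI => //; exact: mK.
  have mX : measurable X by apply: measurableI => //; exact: mK.
  (* The whole space serves as the event carrying the error. *)
  rewrite -[dl * h]mulr1 -[X in _ <= _ * X](prT P).
  apply: pr_product_approx => // x.
  rewrite preimage_setT prT mulr1.
  have [tx|xt] := ltP t (tau1 x).
    have Y0 : pair x @^-1` Y = set0.
      rewrite /Y K2E//; apply/seteqP; split => // y [_ /= [+ _]].
      by rewrite subr_ge0 leNgt tx.
    rewrite /X preimage_setI Y0 set0I pr0 mul0r subr0 normr0.
    by rewrite mulr_ge0// ltW.
  have hAx := trace2 xt hA.
  have YE : pair x @^-1` Y = pair x @^-1` A `&` J2 (t - tau1 x) @^-1` [set b].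
    rewrite /Y K2E//; apply/seteqP; split => y /=; first by move=> [? []].
    by rewrite subr_ge0 xt => -[].
  have XE : pair x @^-1` X = pair x @^-1` A `&` J2 (t - tau1 x) @^-1` [set b] `&`
      J2 (t - tau1 x + h) @^-1` [set b'].
    rewrite /X preimage_setI YE K2E// addrAC; congr (_ `&` _).
    apply/seteqP; split => y /=; first by case.
    by move=> ->; split => //; lra.
  have tx0 : 0 <= t - tau1 x by rewrite subr_ge0.
  have hE : 0 <= h < e3 by rewrite h0.
  by rewrite XE YE; exact: (H3 h _ _ _ _ hE tx0 hAx).
Qed.

Lemma regular_concat : exists K', regular_process P (row_mx alpha1 0)
  (concat_intensity S1 alpha2 S2) K' (fun w => tau1 w.1 + tau2 w.2).
Proof.
exists K; split.
- exact: pK.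
- exact: concat_inf_markov.
- move=> j; case: (split_ordP j) => i ->.
    rewrite row_mxEl -emb1_lshift K1E// pr_product_rect ?prT ?mulr1//.
      exact: (regular_start rJ1).
    exact: paths_measurable.
  (* The second block is occupied at time 0 only if the first process starts in its cemetery, which
     is a null event. *)
  rewrite row_mxEr mxE -emb2_lshift; apply/eqP; rewrite eq_le pr_ge0 andbT.
  apply: (@le_trans _ _ (pr P (J1 0 @^-1` [set cemetery q1] `*` setT))); last first.
    rewrite pr_product_rect//; last exact: paths_measurable.
    by rewrite (regular_start_cemetery pJ1 pa1 (regular_start rJ1)) mul0r.
  apply: le_pr; first exact: mK.
    by apply: measurableX => //; exact: paths_measurable.
  move=> [x y]; rewrite K2E//= => -[x0 _]; split => //=.
  by apply/(regular_timeP rJ1 x (lexx 0)); rewrite -subr_ge0.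
- move=> w; apply: addr_ge0; [exact: (regular_time_ge0 rJ1)|exact: (regular_time_ge0 rJ2)].
- move=> [x y] t t0 /=; rewrite -emb2_cemetery.
  have -> : (K t (x, y) = emb2 q1 (cemetery q2)) =
      (K t @^-1` [set emb2 q1 (cemetery q2)]) (x, y) by [].
  rewrite K2E//= subr_ge0; split.
    move=> [xt Jc]; have tx0 : 0 <= t - tau1 x by rewrite subr_ge0.
    by have := proj1 (regular_timeP rJ2 y tx0) Jc; rewrite lerBrDl.
  move=> xyt; have xt : tau1 x <= t.
    by rewrite (le_trans _ xyt)// lerDl (regular_time_ge0 rJ2).
  by split => //; apply/(regular_timeP rJ2); rewrite ?subr_ge0// lerBrDl.
Qed.

End concat.

(** * Conditioning, sums and mixtures *)

Section conditional.
Context (d : measure_display) (Omega : measurableType d) (R : realType).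
Context (P : probability Omega R) (D : set Omega) (mD : measurable D).

(** [P] is the default of the normalization, taken when [D] is null; it keeps [cond_prob] a
    probability for every [D]. *)
Definition cond_prob : probability Omega R := mnormalize (mrestr P mD) P.

Lemma pr_cond_prob A : 0 < pr P D -> measurable A ->
  pr cond_prob A = pr P (A `&` D) / pr P D.
Proof.
move=> D0 mA; have PD : P D = (pr P D)%:E by exact: prK.
rewrite {1}/pr /cond_prob/= /mnormalize/= {1 2}/mrestr setTI PD.
rewrite eqe gt_eqF//= /mrestr setTI PD/= -[P (A `&` D)]fineK ?fin_num_measure//.
exact: measurableI.
Qed.

End conditional.

Lemma probability_rect_unique (d1 d2 : measure_display) (T1 : measurableType d1)
    (T2 : measurableType d2) (R : realType) (m1 m2 : probability (T1 * T2)%type R) :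
  (forall A B, measurable A -> measurable B -> m1 (A `*` B) = m2 (A `*` B)) ->
  forall X, measurable X -> m1 X = m2 X.
Proof.
move=> H X mX.
pose C : set (set (T1 * T2)) :=
  [set A `*` B | A in measurable & B in measurable].
apply: (measure_unique C (fun=> setT)) => //.
- exact: measurable_prod_measurableType.
- move=> _ _ [A1 mA1 [B1 mB1 <-]] [A2 mA2 [B2 mB2 <-]].
  exists (A1 `&` A2); first exact: measurableI.
  by exists (B1 `&` B2); [exact: measurableI|rewrite setXI].
- by move=> _; exists setT => //; exists setT => //; rewrite setXTT.
- by apply/seteqP; split => // w _; exists 0%N.
- by move=> _ [A mA [B mB <-]]; exact: H.
- by move=> _; rewrite -ge0_fin_numE// fin_num_measure.
Qed.

(** Rectangles determine joint laws, also for pairs living on different spaces; independence is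
    thereby transported to product spaces and to conditional measures. *)
Lemma pr_pair_unique (d1 d2 d1' d2' : measure_display) (Om1 : measurableType d1)
    (Om2 : measurableType d2) (T : measurableType d1') (T' : measurableType d2')
    (R : realType) (P1 : probability Om1 R) (P2 : probability Om2 R)
    (f1 : Om1 -> T) (g1 : Om1 -> T') (f2 : Om2 -> T) (g2 : Om2 -> T') :
  measurable_fun setT f1 -> measurable_fun setT g1 ->
  measurable_fun setT f2 -> measurable_fun setT g2 ->
  (forall A B, measurable A -> measurable B ->
    pr P1 (f1 @^-1` A `&` g1 @^-1` B) = pr P2 (f2 @^-1` A `&` g2 @^-1` B)) ->
  forall X, measurable X ->
    pr P1 ((fun w => (f1 w, g1 w)) @^-1` X) =
    pr P2 ((fun w => (f2 w, g2 w)) @^-1` X).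
Proof.
move=> mf1 mg1 mf2 mg2 H X mX.
have m1 : measurable_fun setT (fun w => (f1 w, g1 w)) by exact: measurable_fun_pair.
have m2 : measurable_fun setT (fun w => (f2 w, g2 w)) by exact: measurable_fun_pair.
pose h1 : {mfun Om1 >-> (T * T')%type} := mfun_Sub (mem_set m1).
pose h2 : {mfun Om2 >-> (T * T')%type} := mfun_Sub (mem_set m2).
have : distribution P1 h1 X = distribution P2 h2 X.
  apply: probability_rect_unique mX => A B mA mB.
  have mp d (Om : measurableType d) (f : Om -> T) (g : Om -> T') :
      measurable_fun setT f -> measurable_fun setT g ->
      measurable (f @^-1` A `&` g @^-1` B).
    move=> mf mg; apply: measurableI.
      by rewrite -[_ @^-1` _]setTI; exact: mf.
    by rewrite -[_ @^-1` _]setTI; exact: mg.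
  change (P1 (f1 @^-1` A `&` g1 @^-1` B) = P2 (f2 @^-1` A `&` g2 @^-1` B)).
  by rewrite prK ?[RHS]prK ?H//; exact: mp.
by rewrite /distribution /pushforward /pr /= => ->.
Qed.

Lemma measurable_preimageT (d d' : measure_display) (T : measurableType d)
    (T' : measurableType d') (f : T -> T') A :
  measurable_fun setT f -> measurable A -> measurable (f @^-1` A).
Proof. by move=> mf mA; rewrite -[_ @^-1` _]setTI; exact: mf. Qed.

(** By independence [(V, W)] has the law of the two absorption times on the product space, where the
    concatenated process is absorbed at their sum. *)
Lemma regular_phase_type_add (d : measure_display) (Om : measurableType d)
    (R : realType) (Q : probability Om R) (V W : Om -> R) :
  measurable_fun setT V -> measurable_fun setT W ->
  (forall A B, measurable A -> measurable B ->
    pr Q (V @^-1` A `&` W @^-1` B) = pr Q (V @^-1` A) * pr Q (W @^-1` B)) ->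
  regular_phase_type (fun A => pr Q (V @^-1` A)) ->
  regular_phase_type (fun A => pr Q (W @^-1` A)) ->
  regular_phase_type (fun A => pr Q ((fun w => V w + W w) @^-1` A)).
Proof.
move=> mV mW VW.
move=> [q1 [a1 [S1 [pa1 tS1 [d1 [Om1 [P1 [J1 [tau1 [rJ1 E1]]]]]]]]]].
move=> [q2 [a2 [S2 [pa2 tS2 [d2 [Om2 [P2 [J2 [tau2 [rJ2 E2]]]]]]]]]].
have mt1 := regular_time_measurable rJ1.
have mt2 := regular_time_measurable rJ2.
exists (q1 + q2)%N, (row_mx a1 0), (concat_intensity S1 a2 S2); split.
- split=> [j|].
    case: (split_ordP j) => i ->; rewrite ?row_mxEl ?row_mxEr ?mxE//.
    exact: (proj1 pa1).
  rewrite big_split_ord/= -[RHS](proj2 pa1) [X in _ + X]big1 ?addr0.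
    by apply: eq_bigr => i _; rewrite row_mxEl.
  by move=> i _; rewrite row_mxEr mxE.
- exact: concat_transient.
have [K rK] := regular_concat tS1 pa1 pa2 rJ1 rJ2.
exists _, _, (P1 \x P2)%E, K, (fun w => tau1 w.1 + tau2 w.2); split => // A mA.
pose X := (fun xy : R * R => xy.1 + xy.2) @^-1` A.
have mX : measurable X.
  by apply: measurable_preimageT => //; apply: measurable_funD;
    [exact: measurable_fst|exact: measurable_snd].
have mf : measurable_fun setT (tau1 \o fst : Om1 * Om2 -> R).
  exact: measurableT_comp mt1 measurable_fst.
have mg : measurable_fun setT (tau2 \o snd : Om1 * Om2 -> R).
  exact: measurableT_comp mt2 measurable_snd.
apply: (pr_pair_unique (P1 := Q) (P2 := (P1 \x P2)%E) mV mW mf mg _ mX).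
move=> B C mB mC; rewrite VW// E1// E2//.
rewrite -(pr_product_rect P1 P2); [by []|exact: measurable_preimageT..].
Qed.

Section embedding.
Context (d : measure_display) (Omega : measurableType d) (R : realType).
Context (P : probability Omega R) (n' n : nat) (L' : 'M[R]_n') (L : 'M[R]_n).
Context (f : 'I_n' -> 'I_n) (J : R -> Omega -> 'I_n').
Hypothesis f_inj : injective f.
Hypothesis Lf : forall j k, L (f j) (f k) = L' j k.
Hypothesis Lf0 : forall j k, (forall k', k != f k') -> L (f j) k = 0.

Let preim_f t k : (fun w => f (J t w)) @^-1` [set f k] = J t @^-1` [set k].
Proof. by apply/seteqP; split => w /=; [move/f_inj|move=> ->]. Qed.

Let preim_nf t k : (forall k', k != f k') ->
  (fun w => f (J t w)) @^-1` [set k] = set0.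
Proof.
by move=> H; apply/seteqP; split => // w /= E; have := H (J t w); rewrite E eqxx.
Qed.

Let cases k : (exists k', k = f k') \/ (forall k', k != f k').
Proof.
have [[k' ->]|H] := pselect (exists k', k = f k'); first by left; exists k'.
by right=> k'; apply/eqP => E; apply: H; exists k'.
Qed.

Lemma embed_paths : jump_paths J -> jump_paths (fun t w => f (J t w)).
Proof.
move=> pJ; split.
- move=> t k t0; have [[k' ->]|H] := cases k; last by rewrite preim_nf.
  by rewrite preim_f; exact: paths_measurable.
- move=> w t t0; have /near_rightP[e e0 H] := paths_right_continuous pJ w t0.
  by apply/near_rightP; exists e => // y ye; rewrite H.
- move=> w t t0; have [k /near_leftP[e e0 H]] := paths_left_limits pJ w t0.
  by exists (f k); apply/near_leftP; exists e => // y ye; rewrite H.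
Qed.

Lemma embed_history D A : history (fun t w => f (J t w)) D A -> history J D A.
Proof.
move=> hA; have [B hB] : exists2 B, history J D B &
    id @^-1` A `&` setT = id @^-1` B `&` setT.
  apply: history_trace hA => t k Dt; have [[k' ->]|H] := cases k.
    by exists (J t @^-1` [set k']); [exact: history_state|rewrite !preimage_id preim_f].
  by exists set0; [exact: sigma_algebra0|rewrite !preimage_id preim_nf].
by rewrite !setIT !preimage_id => ->.
Qed.

(** States outside the range of [f] are never visited, and [Lf0] forbids rates towards them from the
    range, so both sides vanish there. *)
Lemma embed_inf_markov : inf_markov P L' J ->
  inf_markov P L (fun t w => f (J t w)).
Proof.
move=> iJ dl dl0; have [e e0 H] := iJ dl dl0.
exists e => // h t A j k he t0 /embed_history hA; have [h0 _] := andP he.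
have dh : 0 <= dl * h by rewrite mulr_ge0// ltW.
have [[j' ->]|nj] := cases j; last first.
  by rewrite (preim_nf _ nj) setI0 set0I pr0 mul0r subrr normr0.
rewrite preim_f; have [[k' ->]|nk] := cases k.
  by rewrite preim_f Lf (inj_eq f_inj); exact: H.
rewrite (preim_nf _ nk) setI0 pr0 Lf0// mulr0 addr0 eq_sym (negbTE (nk j')).
by rewrite mulr0 subrr normr0.
Qed.

End embedding.

Section mixture.
Context (d1 d2 : measure_display) (Om1 : measurableType d1)
  (Om2 : measurableType d2) (R : realType).
Context (P1 : probability Om1 R) (P2 : probability Om2 R) (a : R).
Hypothesis a01 : 0 <= a <= 1.
Let Q := (bernoulli_prob a \x (P1 \x P2))%E
  : probability (bool * (Om1 * Om2))%type R.

(** The sample space holds a coin and a point of each space; the coin selects which point matters.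
    Such events are closed under intersection, their probability is a convex combination, and all
    events of the history of the mixture have this form. *)
Definition switch (X1 : set Om1) (X2 : set Om2) : set (bool * (Om1 * Om2)) :=
  [set w | if w.1 then X1 w.2.1 else X2 w.2.2].

Let switchE X1 X2 : switch X1 X2 =
  ([set true] `*` (X1 `*` setT)) `|` ([set false] `*` (setT `*` X2)).
Proof.
apply/seteqP; split => -[[] [x y]]; rewrite /switch/=.
- by left.
- by right.
- by move=> [[_ []]//|[//]].
- by move=> [[//]|[_ []]].
Qed.

Lemma measurable_switch X1 X2 :
  measurable X1 -> measurable X2 -> measurable (switch X1 X2).
Proof.
move=> m1 m2; rewrite switchE.
by apply: measurableU; apply: measurableX => //; exact: measurableX.
Qed.

Lemma switchI X1 X2 Y1 Y2 :
  switch X1 X2 `&` switch Y1 Y2 = switch (X1 `&` Y1) (X2 `&` Y2).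
Proof. by apply/seteqP; split => -[[] [x y]]. Qed.

Lemma pr_switch X1 X2 : measurable X1 -> measurable X2 ->
  pr Q (switch X1 X2) = a * pr P1 X1 + (1 - a) * pr P2 X2.
Proof.
move=> m1 m2.
have r1 : pr Q ([set true] `*` (X1 `*` setT)) = a * pr P1 X1.
  rewrite pr_product_rect//; last exact: measurableX.
  rewrite pr_product_rect// prT mulr1 {1}/pr/= bernoulli_probE//.
  have e1 : (true \in [set true]) = true by exact: mem_set.
  have e2 : (false \in [set true]) = false by apply: memNset.
  by rewrite !diracE e1 e2 mule1 mule0 adde0.
have r2 : pr Q ([set false] `*` (setT `*` X2)) = (1 - a) * pr P2 X2.
  rewrite pr_product_rect//; last exact: measurableX.
  rewrite pr_product_rect// prT mul1r {1}/pr/= bernoulli_probE//.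
  have e1 : (false \in [set false]) = true by exact: mem_set.
  have e2 : (true \in [set false]) = false by apply: memNset.
  by rewrite !diracE e1 e2 mule1 mule0 add0e.
rewrite -r1 -r2 switchE /pr measureU; first last.
- by apply/seteqP; split => // -[b w] [[/= -> _] []].
- by apply: measurableX => //; exact: measurableX.
- by apply: measurableX => //; exact: measurableX.
by rewrite fineD// fin_num_measure//; apply: measurableX => //; exact: measurableX.
Qed.

Context (n : nat) (L : 'M[R]_n).
Context (J1 : R -> Om1 -> 'I_n) (J2 : R -> Om2 -> 'I_n).
Hypotheses (pJ1 : jump_paths J1) (pJ2 : jump_paths J2).

Definition mixture_process t (w : bool * (Om1 * Om2)) : 'I_n :=
  if w.1 then J1 t w.2.1 else J2 t w.2.2.
Let K := mixture_process.

Lemma mixture_preimage t k :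
  K t @^-1` [set k] = switch (J1 t @^-1` [set k]) (J2 t @^-1` [set k]).
Proof. by apply/seteqP; split => -[[] [x y]]. Qed.

Lemma mixture_paths : jump_paths K.
Proof.
split.
- move=> t k t0; rewrite mixture_preimage.
  by apply: measurable_switch; exact: paths_measurable.
- by move=> [[] [x y]] t t0; [exact: (paths_right_continuous pJ1)|
    exact: (paths_right_continuous pJ2)].
- by move=> [[] [x y]] t t0; [exact: (paths_left_limits pJ1)|
    exact: (paths_left_limits pJ2)].
Qed.

Lemma mixture_history D A : history K D A ->
  exists2 A1, history J1 D A1 & exists2 A2, history J2 D A2 & A = switch A1 A2.
Proof.
move=> hA.
have [A1 h1 E1] : exists2 B, history J1 D B &
    pair true @^-1` A `&` setT = fst @^-1` B `&` setT.
  apply: history_trace hA => t k Dt; exists (J1 t @^-1` [set k]) => //.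
  by apply: history_state.
have [A2 h2 E2] : exists2 B, history J2 D B &
    pair false @^-1` A `&` setT = snd @^-1` B `&` setT.
  apply: history_trace hA => t k Dt; exists (J2 t @^-1` [set k]) => //.
  by apply: history_state.
exists A1 => //; exists A2 => //; rewrite !setIT in E1 E2.
have e1 x y : A (true, (x, y)) = A1 x by exact: (congr1 (fun X => X (x, y)) E1).
have e2 x y : A (false, (x, y)) = A2 y by exact: (congr1 (fun X => X (x, y)) E2).
by apply/seteqP; split => -[[] [x y]]; rewrite /switch/= ?e1 ?e2.
Qed.

Lemma mixture_inf_markov :
  inf_markov P1 L J1 -> inf_markov P2 L J2 -> inf_markov Q L K.
Proof.
move=> i1 i2 dl dl0; have [e1 e10 H1] := i1 _ dl0; have [e2 e20 H2] := i2 _ dl0.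
exists (Num.min e1 e2); first by rewrite lt_min e10.
move=> h t A j k /andP[h0]; rewrite lt_min => /andP[he1 he2] t0.
move=> /mixture_history[A1 h1 [A2 h2 ->]].
have mA1 := history_itv_measurable pJ1 h1.
have mA2 := history_itv_measurable pJ2 h2.
have th0 : 0 <= t + h by rewrite addr_ge0.
have m1 s i : 0 <= s -> measurable (J1 s @^-1` [set i]) by exact: paths_measurable.
have m2 s i : 0 <= s -> measurable (J2 s @^-1` [set i]) by exact: paths_measurable.
rewrite !mixture_preimage !switchI !pr_switch;
  do ?[apply: measurableI|apply: m1|apply: m2] => //.
have := H1 h t A1 j k; rewrite h0 he1 => /(_ isT t0 h1).
have := H2 h t A2 j k; rewrite h0 he2 => /(_ isT t0 h2).
set x2 := pr P2 _; set y2 := pr P2 _; set x1 := pr P1 _; set y1 := pr P1 _.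
set c := _%:R + _ => b2 b1; case/andP: a01 => a0 a1.
rewrite (_ : _ - _ = a * (x1 - y1 * c) + (1 - a) * (x2 - y2 * c)); last by ring.
apply: (le_trans (ler_normD _ _)); rewrite !normrM (ger0_norm a0).
rewrite (@ger0_norm _ (1 - a)) ?subr_ge0//.
rewrite [leRHS](_ : _ = a * (dl * h) + (1 - a) * (dl * h)); last by ring.
by rewrite lerD// ler_wpM2l// subr_ge0.
Qed.

End mixture.

Definition mix_intensity (R : realType) (q1 q2 : nat) (S1 : 'M[R]_q1)
    (S2 : 'M[R]_q2) : 'M[R]_(q1 + q2) := block_mx S1 0 0 S2.

Section mix_intensity.
Context (R : realType) (q1 q2 : nat) (S1 : 'M[R]_q1) (S2 : 'M[R]_q2).
Let S := mix_intensity S1 S2.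

Let ul a c : S (lshift _ a) (lshift _ c) = S1 a c.
Proof. by rewrite /S /mix_intensity block_mxEul. Qed.

Let ur a b : S (lshift _ a) (rshift _ b) = 0.
Proof. by rewrite /S /mix_intensity block_mxEur mxE. Qed.

Let dl b c : S (rshift _ b) (lshift _ c) = 0.
Proof. by rewrite /S /mix_intensity block_mxEdl mxE. Qed.

Let dr b c : S (rshift _ b) (rshift _ c) = S2 b c.
Proof. by rewrite /S /mix_intensity block_mxEdr. Qed.

Let row1 a : \sum_k S (lshift _ a) k = \sum_k S1 a k.
Proof.
rewrite big_split_ord/= [X in _ + X]big1 ?addr0; last by move=> c _; rewrite ur.
by apply: eq_bigr => c _; rewrite ul.
Qed.

Let row2 b : \sum_k S (rshift _ b) k = \sum_k S2 b k.
Proof.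
rewrite big_split_ord/= big1 ?add0r; last by move=> c _; rewrite dl.
by apply: eq_bigr => c _; rewrite dr.
Qed.

Lemma mix_transient : transient_subintensity S1 -> transient_subintensity S2 ->
  transient_subintensity S.
Proof.
move=> tS1 tS2; split.
- move=> j k; case: (split_ordP j) => a ->; case: (split_ordP k) => b -> ab.
  + rewrite ul; apply: (subintensity_offdiag tS1).
    by rewrite (inj_eq (@lshift_inj _ _)) in ab.
  + by rewrite ur.
  + by rewrite dl.
  + rewrite dr; apply: (subintensity_offdiag tS2).
    by rewrite (inj_eq (@rshift_inj _ _)) in ab.
- move=> j; case: (split_ordP j) => a ->.
  + by rewrite ul (subintensity_diag tS1).
  + by rewrite dr (subintensity_diag tS2).
- move=> j; case: (split_ordP j) => a ->.
  + by rewrite row1 (subintensity_rowsum tS1).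
  + by rewrite row2 (subintensity_rowsum tS2).
- rewrite unitmxE /S /mix_intensity det_ublock unitrM -!unitmxE.
  by rewrite (subintensity_transient tS1) (subintensity_transient tS2).
Qed.

Lemma mix_emb1 j k : absorbing_intensity S (emb1 q2 j) (emb1 q2 k) =
  absorbing_intensity S1 j k.
Proof.
have [->|[b ->]] := ord_cemetery j; first by rewrite emb1_cemetery !absorbing_cemetery.
have [->|[c ->]] := ord_cemetery k; rewrite emb1_lshift.
  by rewrite emb1_cemetery !absorbing_exit row1.
by rewrite emb1_lshift !absorbing_transient ul.
Qed.

Lemma mix_emb2 j k : absorbing_intensity S (emb2 q1 j) (emb2 q1 k) =
  absorbing_intensity S2 j k.
Proof.
have [->|[b ->]] := ord_cemetery j; first by rewrite emb2_cemetery !absorbing_cemetery.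
have [->|[c ->]] := ord_cemetery k; rewrite emb2_lshift.
  by rewrite emb2_cemetery !absorbing_exit row2.
by rewrite emb2_lshift !absorbing_transient dr.
Qed.

(** Since the cemetery is shared, only transient states of the second block lie outside the range of
    [emb1], and the off-diagonal block towards them is 0. *)
Lemma mix_emb1_out j k : (forall k', k != emb1 q2 k') ->
  absorbing_intensity S (emb1 q2 j) k = 0.
Proof.
move=> nk; have [->|[b ->]] := ord_cemetery j.
  by rewrite emb1_cemetery absorbing_cemetery.
rewrite emb1_lshift; have [[a ka]|[c kc]] := emb_cases k.
  by have := nk (lshift 1 a); rewrite ka eqxx.
have [c0|[c' cc']] := ord_cemetery c; rewrite kc.
  by have := nk (cemetery q1); rewrite kc c0 emb1_cemetery emb2_cemetery eqxx.
by rewrite cc' emb2_lshift absorbing_transient ur.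
Qed.

Lemma mix_emb2_out j k : (forall k', k != emb2 q1 k') ->
  absorbing_intensity S (emb2 q1 j) k = 0.
Proof.
move=> nk; have [->|[b ->]] := ord_cemetery j.
  by rewrite emb2_cemetery absorbing_cemetery.
rewrite emb2_lshift; have [[a ->]|[c kc]] := emb_cases k.
  by rewrite emb1_lshift absorbing_transient dl.
by have := nk c; rewrite kc eqxx.
Qed.

End mix_intensity.

Lemma regular_phase_type_mix (R : realType) (mu nu : set R -> R) (a : R) :
  0 <= a <= 1 -> regular_phase_type mu -> regular_phase_type nu ->
  regular_phase_type (fun A => a * mu A + (1 - a) * nu A).
Proof.
move=> a01.
move=> [q1 [a1 [S1 [pa1 tS1 [d1 [Om1 [P1 [J1 [tau1 [rJ1 E1]]]]]]]]]].
move=> [q2 [a2 [S2 [pa2 tS2 [d2 [Om2 [P2 [J2 [tau2 [rJ2 E2]]]]]]]]]].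
have mt1 := regular_time_measurable rJ1.
have mt2 := regular_time_measurable rJ2.
have [a0 a1'] := andP a01.
exists (q1 + q2)%N, (row_mx (a *: a1) ((1 - a) *: a2)), (mix_intensity S1 S2).
split.
- split=> [j|].
    case: (split_ordP j) => i ->; rewrite ?row_mxEl ?row_mxEr ?mxE.
      by rewrite mulr_ge0// (proj1 pa1).
    by rewrite mulr_ge0 ?subr_ge0// (proj1 pa2).
  rewrite big_split_ord/=; under eq_bigr do rewrite row_mxEl mxE.
  under [X in _ + X]eq_bigr do rewrite row_mxEr mxE.
  by rewrite -!mulr_sumr (proj2 pa1) (proj2 pa2) !mulr1 subrKC.
- exact: mix_transient.
pose I1 t w := emb1 q2 (J1 t w); pose I2 t w := emb2 q1 (J2 t w).
have pI1 : jump_paths I1 := embed_paths (@emb1_inj q1 q2) (regular_paths rJ1).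
have pI2 : jump_paths I2 := embed_paths (@emb2_inj q1 q2) (regular_paths rJ2).
pose tau (w : bool * (Om1 * Om2)) := if w.1 then tau1 w.2.1 else tau2 w.2.2.
exists _, _, (bernoulli_prob a \x (P1 \x P2))%E, (mixture_process I1 I2), tau.
split; last first.
  move=> A mA; rewrite E1// E2// -(pr_switch P1 P2 a01);
    [|exact: measurable_preimageT..].
  by congr pr; apply/seteqP; split => -[[] [x y]].
split.
- exact: mixture_paths.
- apply: mixture_inf_markov => //.
  + apply: embed_inf_markov (regular_inf_markov rJ1) => //.
    * exact: emb1_inj.
    * exact: mix_emb1.
    * exact: mix_emb1_out.
  + apply: embed_inf_markov (regular_inf_markov rJ2) => //.
    * exact: emb2_inj.
    * exact: mix_emb2.
    * exact: mix_emb2_out.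
- move=> j; rewrite mixture_preimage pr_switch//; last 2 first.
  + exact: paths_measurable.
  + exact: paths_measurable.
  case: (split_ordP j) => i ->.
    rewrite row_mxEl mxE -(regular_start rJ1) (_ : I2 0 @^-1` _ = set0).
      rewrite pr0 mulr0 addr0; congr (_ * pr _ _); apply/seteqP.
      rewrite -emb1_lshift; split => w /=; first by move/emb1_inj.
      by rewrite /I1 => ->.
    apply/seteqP; split => // w /=; rewrite -emb1_lshift => /eqP.
    by rewrite eq_sym (negbTE (emb1_neq_emb2 _ _)).
  rewrite row_mxEr mxE -(regular_start rJ2) (_ : I1 0 @^-1` _ = set0).
    rewrite pr0 mulr0 add0r; congr (_ * pr _ _); apply/seteqP.
    rewrite -emb2_lshift; split => w /=; first by move/emb2_inj.
    by rewrite /I2 => ->.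
  apply/seteqP; split => // w /=; rewrite /I1.
  have [->|[b ->]] := ord_cemetery (J1 0 w).
    by rewrite emb1_cemetery => /eqP; rewrite eq_sym (negbTE (lshift_neq_cemetery _)).
  by rewrite -emb2_lshift => /eqP; rewrite (negbTE (emb1_neq_emb2 _ _)).
- by move=> [[] [x y]]; [exact: (regular_time_ge0 rJ1)|exact: (regular_time_ge0 rJ2)].
- move=> [[] [x y]] t t0; rewrite /mixture_process /tau/=.
    rewrite -(regular_timeP rJ1 x t0) /I1 -(emb1_cemetery q1 q2).
    by split => [/emb1_inj|->].
  rewrite -(regular_timeP rJ2 y t0) /I2 -(emb2_cemetery q1 q2).
  by split => [/emb2_inj|->].
Qed.

(** Induction on [n], splitting off the last component with its relative weight; dividing by the
    total weight keeps the partial mixtures probability laws. If the last weight or the sum of the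
    others is 0, one side of the mixture need not be regular, hence the two degenerate cases. *)
Lemma regular_phase_type_sum (R : realType) (n : nat) (c : 'I_n -> R)
    (mu : 'I_n -> set R -> R) :
  (forall i, 0 <= c i) -> (forall i, 0 < c i -> regular_phase_type (mu i)) ->
  0 < \sum_i c i ->
  regular_phase_type (fun A => (\sum_i c i * mu i A) / \sum_i c i).
Proof.
elim: n c mu => [|n IH] c mu c0 H; first by rewrite big_ord0 ltxx.
set s := \sum_(i < n) c (widen_ord (leqnSn n) i).
have s0 : 0 <= s by rewrite sumr_ge0.
have Es : \sum_i c i = s + c ord_max by rewrite big_ord_recr.
rewrite Es => sc0.
have Em A : \sum_i c i * mu i A =
    \sum_(i < n) c (widen_ord (leqnSn n) i) * mu (widen_ord (leqnSn n) i) A +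
    c ord_max * mu ord_max A by rewrite big_ord_recr.
have [cn0|cn0] := eqVneq (c ord_max) 0.
  rewrite cn0 addr0 in sc0 *.
  rewrite (_ : (fun A => _) = fun A => (\sum_(i < n) c (widen_ord (leqnSn n) i) *
    mu (widen_ord (leqnSn n) i) A) / s); first by apply: IH => // i; exact: H.
  by apply/funext => A; rewrite Em cn0 mul0r addr0.
have cn : 0 < c ord_max by rewrite lt0r cn0 c0.
have [s00|sn0] := eqVneq s 0.
  rewrite (_ : (fun A => _) = mu ord_max); first exact: H.
  apply/funext => A; rewrite Em s00 add0r big1 ?add0r; last first.
    move=> i _; suff -> : c (widen_ord (leqnSn n) i) = 0 by rewrite mul0r.
    apply/eqP; rewrite eq_le c0 andbT -s00 /s (bigD1 i)//= lerDl.
    by rewrite sumr_ge0.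
  by rewrite mulrAC divff// mul1r.
have sp : 0 < s by rewrite lt0r sn0.
rewrite (_ : (fun A => _) = fun A =>
  (s / (s + c ord_max)) * ((\sum_(i < n) c (widen_ord (leqnSn n) i) *
    mu (widen_ord (leqnSn n) i) A) / s) +
  (1 - s / (s + c ord_max)) * mu ord_max A).
  apply: regular_phase_type_mix; last exact: H.
    by rewrite divr_ge0 ?(ltW sc0)//= ler_pdivrMr// mul1r lerDl.
  by apply: IH => // i; exact: H.
apply/funext => A; rewrite Em; field.
by rewrite (gt_eqF sp) (gt_eqF sc0).
Qed.

(** * Absorption times, scaling and independent sums *)

Section absorption_time_history.
Context (Omega : Type) (R : realType) (q : nat) (J : R -> Omega -> 'I_(q + 1)).
Hypothesis J_right_continuous : forall w t, 0 <= t ->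
  \forall s \near t^'+, J s w = J t w.
Let D := `[0, +oo[%classic : set R.

Lemma absorption_time_ge0 w : (0 <= absorption_time J w)%E.
Proof. by apply: le_ereal_inf_tmp => _ [s [s0 _] <-]; rewrite lee_fin ltW. Qed.

(** Conditional independence concerns events of the histories, so absorption times must be
    measurable with respect to these. By right continuity, absorption before [t] is visible at a
    positive rational time before [t]. *)
Let history_lt t : history J D [set w | (absorption_time J w < t%:E)%E].
Proof.
pose F n := if (unpickle n : option rat) is Some r then
  if 0 < (ratr r : R) < t then J (ratr r) @^-1` [set cemetery q] else set0
  else set0.
have -> : [set w | (absorption_time J w < t%:E)%E] = \bigcup_n F n; last first.
  apply: history_bigcup => n; rewrite /F.
  case: unpickle => [r|]; last exact: sigma_algebra0.
  case: ifPn => [/andP[r0 _]|_]; last exact: sigma_algebra0.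
  by apply: history_state; rewrite /D /= in_itv/= andbT ltW.
apply/seteqP; split => w /=.
  move=> /ereal_inf_lt[_ [s [s0 sc] <-]]; rewrite lte_fin => st.
  have /near_rightP[e e0 He] := J_right_continuous w (ltW s0).
  have [r] : exists r : rat, ratr r \in `]s, (Num.min (s + e) t)[.
    by apply: rat_in_itvoo; rewrite lt_min st ltrDl e0.
  rewrite in_itv/= lt_min => /and3P[sr re rt].
  exists (pickle r); first exact: I.
  rewrite /F pickleK (lt_trans s0 sr) rt/=.
  by rewrite He// sr.
move=> [n _]; rewrite /F; case: unpickle => [r|//]; case: ifPn => // /andP[r0 rt] rc.
apply: (@le_lt_trans _ _ (ratr r)%:E); last by rewrite lte_fin.
by apply: ereal_inf_lbound; exists (ratr r).
Qed.

Lemma history_absorption_time_pinfty :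
  history J D [set w | absorption_time J w = +oo%E].
Proof.
rewrite (_ : [set _ | _] =
    ~` \bigcup_n [set w | (absorption_time J w < n%:R%:E)%E]).
  by apply: historyC; apply: history_bigcup => n; exact: history_lt.
apply/seteqP; split => w /=; first by move=> E [n _] /=; rewrite E ltNge leey.
move=> H; apply/eqP; rewrite -leye_eq leNgt; apply/negP => Hy.
have Hfin : absorption_time J w \is a fin_num.
  by rewrite ge0_fin_numE ?absorption_time_ge0.
apply: H; exists (Num.truncn (fine (absorption_time J w))).+1 => //=.
by rewrite -(fineK Hfin) lte_fin/= truncnS_gt.
Qed.

Let history_fine_le t :
  history J D [set w | fine (absorption_time J w) <= t].
Proof.
have [t0|t0] := ltP t 0.
  rewrite (_ : [set _ | _] = set0); first exact: sigma_algebra0.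
  apply/seteqP; split => // w /=.
  by rewrite leNgt (lt_le_trans t0)// fine_ge0// absorption_time_ge0.
(* [fine] sends +oo to 0, so for 0 <= t the event also contains the paths that are never
   absorbed. *)
rewrite (_ : [set _ | _] = [set w | absorption_time J w = +oo%E] `|`
    ~` \bigcup_n ~` [set w | (absorption_time J w < (t + n.+1%:R^-1)%:E)%E]).
  apply: historyU; first exact: history_absorption_time_pinfty.
  apply: historyC; apply: history_bigcup => n; apply: historyC.
  exact: history_lt.
apply/seteqP; split => w /=.
  move=> wt; have [wy|wy] := eqVneq (absorption_time J w) +oo%E; first by left.
  right=> -[n _] /=; apply.
  have Hfin : absorption_time J w \is a fin_num.
    by rewrite ge0_fin_numE ?absorption_time_ge0// ltey.
  by rewrite -(fineK Hfin) lte_fin (le_lt_trans wt)// ltrDl invr_gt0.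
move=> [->//|H].
have H' n : (absorption_time J w < (t + n.+1%:R^-1)%:E)%E.
  by apply: contrapT => nH; apply: H; exists n.
have Hfin : absorption_time J w \is a fin_num.
  rewrite ge0_fin_numE ?absorption_time_ge0//.
  by rewrite (lt_le_trans (H' 0%N))// leey.
apply/ler_addgt0Pr => e e0.
have := H' (Num.truncn e^-1); rewrite -(fineK Hfin) lte_fin/= => /ltW/le_trans; apply.
rewrite lerD2l -[leRHS]invrK lef_pV2 ?posrE ?invr_gt0//.
by rewrite ltW// truncnS_gt.
Qed.

Lemma history_absorption_time A : measurable A ->
  history J D ((fun w => fine (absorption_time J w)) @^-1` A).
Proof.
move=> mA; have : @measurable _ (g_sigma_algebraType (@ocitv R)) A by exact: mA.
rewrite RGenOInfty.measurableE; move: A {mA}; apply: smallest_sub.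
  split.
  - by rewrite preimage_set0; exact: sigma_algebra0.
  - by move=> A hA; rewrite setTD; exact: historyC.
  - by move=> F hF; rewrite preimage_bigcup; exact: history_bigcup.
move=> _ [x ->]; rewrite (_ : _ @^-1` _ =
  ~` [set w | fine (absorption_time J w) <= x]); first exact: historyC.
apply/seteqP; split => w /=; rewrite in_itv/= andbT ltNge; first by move/negP.
by move/negP.
Qed.

End absorption_time_history.

(** [D] belongs to the history at time 0, hence to every past, so [A] may be intersected with it.
    Asking for the error [dl * pr P D] compensates the division by [pr P D]. *)
Lemma cond_inf_markov (d : measure_display) (Omega : measurableType d)
    (R : realType) (P : probability Omega R) (n : nat) (L : 'M[R]_n)
    (J : R -> Omega -> 'I_n) (D : set Omega) (mD : measurable D) :
  jump_paths J -> history J `[0, 0] D -> 0 < pr P D -> inf_markov P L J ->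
  inf_markov (cond_prob P mD) L J.
Proof.
move=> pJ hD D0 iJ dl dl0.
have [e e0 H] := iJ (dl * pr P D) (mulr_gt0 dl0 D0).
exists e => // h t A j k he t0 hA; have [h0 _] := andP he.
have th0 : 0 <= t + h by rewrite addr_ge0.
have mA := history_itv_measurable pJ hA.
have hAD : history J `[0, t] (A `&` D).
  apply: historyI => //; apply: sub_history hD => s /=.
  by rewrite !in_itv/= => /andP[-> s0]; rewrite (le_trans s0).
have m1 : measurable (A `&` J t @^-1` [set j]).
  by apply: measurableI => //; exact: paths_measurable.
rewrite !pr_cond_prob//; last first.
  by apply: measurableI => //; exact: paths_measurable.
have := H h t _ j k he t0 hAD.
rewrite !(setIAC _ D) => {}H.
rewrite mulrAC -mulrBl normrM (@ger0_norm _ (pr P D)^-1) ?invr_ge0 ?pr_ge0//.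
by rewrite ler_pdivrMr// mulrAC.
Qed.

Section scale.
Context (R : realType) (q : nat) (S : 'M[R]_q) (a : R) (a0 : 0 < a).

Lemma scale_transient : transient_subintensity S -> transient_subintensity (a *: S).
Proof.
move=> tS; split.
- by move=> j k jk; rewrite mxE mulr_ge0 ?(ltW a0)// (subintensity_offdiag tS).
- by move=> j; rewrite mxE pmulr_rlt0// (subintensity_diag tS).
- move=> j; under eq_bigr do rewrite mxE.
  by rewrite -mulr_sumr pmulr_rle0// (subintensity_rowsum tS).
- by rewrite unitmxZ ?(subintensity_transient tS)// unitfE gt_eqF.
Qed.

Lemma scale_absorbing j k :
  absorbing_intensity (a *: S) j k = a * absorbing_intensity S j k.
Proof.
have [->|[b ->]] := ord_cemetery j; first by rewrite !absorbing_cemetery mulr0.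
have [->|[c ->]] := ord_cemetery k; last by rewrite !absorbing_transient mxE.
rewrite !absorbing_exit mulrN mulr_sumr; congr (- _).
by apply: eq_bigr => i _; rewrite mxE.
Qed.

Context (d : measure_display) (Omega : measurableType d) (P : probability Omega R).
Context (alpha : 'rV[R]_q) (J : R -> Omega -> 'I_(q + 1)) (tau : Omega -> R).

(** A change of clock: a step of length h becomes one of length a h, so an error [dl / a] for [J]
    gives [dl] after scaling. *)
Lemma regular_scale : regular_process P alpha S J tau ->
  regular_process P alpha (a *: S) (fun t => J (a * t)) (fun w => tau w / a).
Proof.
move=> rJ; have pJ := regular_paths rJ.
have at0 t : 0 <= t -> 0 <= a * t by move=> t0; rewrite mulr_ge0 ?(ltW a0).
split.
- split.
  + by move=> t k t0; apply: paths_measurable => //; exact: at0.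
  + move=> w t t0; have /near_rightP[e e0 H] := paths_right_continuous pJ w (at0 t t0).
    apply/near_rightP; exists (e / a); first by rewrite divr_gt0.
    move=> y /andP[ty ye]; apply: H; rewrite ltr_pM2l// ty/=.
    by rewrite -ltr_pdivlMl// mulrDr mulKf ?gt_eqF// (mulrC a^-1).
  + move=> w t t0; have /(paths_left_limits pJ w)[k] : 0 < a * t by rewrite mulr_gt0.
    move=> /near_leftP[e e0 H]; exists k; apply/near_leftP; exists (e / a).
      by rewrite divr_gt0.
    move=> y /andP[ty ye]; apply: H; rewrite ltr_pM2l// ye andbT.
    by rewrite -ltr_pdivrMl// mulrBr mulKf ?gt_eqF// (mulrC a^-1).
- move=> dl dl0; have [e e0 H] := regular_inf_markov rJ (divr_gt0 dl0 a0).
  exists (e / a); first by rewrite divr_gt0.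
  move=> h t A j k /andP[h0 he] t0 hA.
  have hA' : history J `[0, a * t] A.
    have [B hB] : exists2 B, history J `[0, a * t] B &
        id @^-1` A `&` setT = id @^-1` B `&` setT.
      apply: history_trace hA => s i /=; rewrite in_itv/= => /andP[s0 st].
      exists (J (a * s) @^-1` [set i]) => //; apply: history_state.
      by rewrite /= in_itv/= at0//= ler_pM2l.
    by rewrite !setIT !preimage_id => ->.
  have ahe : 0 <= a * h < e by rewrite at0//= mulrC -ltr_pdivlMr.
  have := H (a * h) (a * t) A j k ahe (at0 t t0) hA'.
  rewrite -mulrDr scale_absorbing (mulrCA h) mulrA => {}H.
  by apply: (le_trans H); rewrite mulrA divfK ?gt_eqF.
- by move=> j; rewrite mulr0; exact: (regular_start rJ).
- by move=> w; rewrite divr_ge0 ?(ltW a0)// (regular_time_ge0 rJ).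
- by move=> w t t0; rewrite (regular_timeP rJ w (at0 t t0)) ler_pdivrMr// mulrC.
Qed.

End scale.

(** Induction on [n], merging the first two variables. Their sum is independent of the others
    because, given an event [D] about the others, the pair keeps its joint law. With indices in
    [nat], the shifted family is a plain pattern matching. *)
Lemma regular_phase_type_indep_sum (d : measure_display) (Om : measurableType d)
    (R : realType) (Q : probability Om R) (n : nat) (Y : nat -> Om -> R) :
  (forall i, measurable_fun setT (Y i)) ->
  (forall i, (i <= n)%N -> regular_phase_type (fun A => pr Q (Y i @^-1` A))) ->
  (forall B : nat -> set R, (forall i, measurable (B i)) ->
    pr Q (\big[setI/setT]_(0 <= i < n.+1) (Y i @^-1` B i)) =
    \prod_(0 <= i < n.+1) pr Q (Y i @^-1` B i)) ->
  regular_phase_type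
    (fun A => pr Q ((fun w => \sum_(0 <= i < n.+1) Y i w) @^-1` A)).
Proof.
elim: n Y => [|n IH] Y mY rY iY.
  rewrite (_ : (fun w => _) = Y 0%N); first exact: rY.
  by apply/funext => w; rewrite big_nat1.
have i01 A B : measurable A -> measurable B ->
    pr Q (Y 0%N @^-1` A `&` Y 1%N @^-1` B) =
    pr Q (Y 0%N @^-1` A) * pr Q (Y 1%N @^-1` B).
  move=> mA mB.
  have := iY (fun i => match i with 0 => A | 1 => B | _ => setT end).
  rewrite !big_nat_recl//= !big1 ?setIT ?mulr1; first by apply => -[|[]].
    by move=> i _; rewrite preimage_setT prT.
  by move=> i _; rewrite preimage_setT.
pose Z i := if i is i'.+1 then Y i'.+2 else fun w => Y 0%N w + Y 1%N w.
rewrite (_ : (fun w => \sum_(0 <= i < n.+2) Y i w) =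
    fun w => \sum_(0 <= i < n.+1) Z i w); last first.
  by apply/funext => w; rewrite !big_nat_recl//= addrA.
have mZ0 : measurable_fun setT (Z 0%N) by apply: measurable_funD; exact: mY.
apply: IH.
- by move=> [|i]; [exact: mZ0|exact: mY].
- move=> [_|i i_n]; last exact: rY.
  by apply: regular_phase_type_add => //; exact: rY.
move=> B mB.
pose D := \big[setI/setT]_(0 <= i < n) (Y i.+2 @^-1` B i.+1).
have mD : measurable D.
  by apply: bigsetI_measurable => i _; exact: measurable_preimageT.
have iD A C : measurable A -> measurable C ->
    pr Q (Y 0%N @^-1` A `&` (Y 1%N @^-1` C `&` D)) =
    pr Q (Y 0%N @^-1` A) * pr Q (Y 1%N @^-1` C) *
    \prod_(0 <= i < n) pr Q (Y i.+2 @^-1` B i.+1).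
  move=> mA mC.
  have := iY (fun i => match i with 0 => A | 1 => C | i'.+2 => B i'.+1 end).
  by rewrite !big_nat_recl//= mulrA; apply => -[|[]].
have DE : pr Q D = \prod_(0 <= i < n) pr Q (Y i.+2 @^-1` B i.+1).
  have := iD setT setT measurableT measurableT.
  by rewrite !preimage_setT !setTI prT !mul1r.
rewrite !big_nat_recl//= -/D -DE.
have mZB : measurable ((fun w => Y 0%N w + Y 1%N w) @^-1` B 0%N).
  exact: measurable_preimageT.
(* A null [D] cannot be conditioned on; both sides are then 0. *)
have [D0|D0] := eqVneq (pr Q D) 0.
  rewrite D0 mulr0; apply/eqP; rewrite eq_le pr_ge0 andbT -D0.
  by apply: le_pr => //; exact: measurableI.
have Dp : 0 < pr Q D by rewrite lt0r D0 pr_ge0.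
apply: (canRL (mulfVK D0)); rewrite -pr_cond_prob//.
pose X := (fun xy : R * R => xy.1 + xy.2) @^-1` B 0%N.
have mX : measurable X.
  by apply: measurable_preimageT => //; apply: measurable_funD;
    [exact: measurable_fst|exact: measurable_snd].
apply: (pr_pair_unique (P1 := cond_prob Q mD) (P2 := Q) (mY 0%N) (mY 1%N)
  (mY 0%N) (mY 1%N) _ mX) => A C mA mC.
rewrite pr_cond_prob//; last by apply: measurableI; exact: measurable_preimageT.
by rewrite -setIA iD// -DE mulfK// i01.
Qed.

(** * Laws given the starting state, and the inner product *)

Section conditioned_on_start.
Context (R : realType) (d p : nat) (pi : 'rV[R]_p) (T : 'I_d.+1 -> 'M[R]_p).
Context (u : 'rV[R]_d.+1) (u0 : forall i, 0 < u 0 i).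
Hypothesis tT : forall i, transient_subintensity (T i).
Context (disp : measure_display) (Om : measurableType disp).
Context (Q : probability Om R) (J : 'I_d.+1 -> R -> Om -> 'I_(p + 1)).
Hypothesis mJ : forall i, markov_jump_process Q (absorbing_intensity (T i)) (J i).
Context (J0 : Om -> 'I_(p + 1)) (JJ0 : forall i w, J i 0 w = J0 w).
Hypothesis finJ : forall i, Q [set w | absorption_time (J i) w = +oo%E] = 0%E.
Context (j : 'I_p) (mD : measurable (J0 @^-1` [set lshift 1 j])).
Hypothesis D0 : 0 < pr Q (J0 @^-1` [set lshift 1 j]).
Hypothesis indJ : conditionally_independent Q
  (fun i => history (J i) `[0, +oo[) (J0 @^-1` [set lshift 1 j]).

Let D := J0 @^-1` [set lshift 1 j].
Let C := cond_prob Q mD.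
Let abst i w := fine (absorption_time (J i) w).

Let pJ i : jump_paths (J i) := markov_jump_process_paths (mJ i).

Let hist_abs i A : measurable A -> history (J i) `[0, +oo[ (abst i @^-1` A).
Proof. exact: history_absorption_time (paths_right_continuous (pJ i)) A. Qed.

Let m_abs i : measurable_fun setT (abst i).
Proof.
move=> _ A mA; rewrite setTI.
exact: (history_measurable (pJ i) (fun _ h => h) (@hist_abs i A mA)).
Qed.

(** Conditioning on the start keeps the infinitesimal property and turns the initial law into a
    point mass at [j]. Regularization takes place under the conditional measure, and multiplying the
    time by [u 0 i] is a change of clock with speed [(u 0 i)^-1]. *)
Lemma regular_conditioned i :
  regular_phase_type (fun A => pr C ((fun w => abst i w * u 0 i) @^-1` A)).
Proof.
have DE : J i 0 @^-1` [set lshift 1 j] = D.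
  by apply/seteqP; split => w /=; rewrite JJ0.
have iC : inf_markov C (absorbing_intensity (T i)) (J i).
  apply: cond_inf_markov => //; last exact: markov_jump_process_inf.
  by rewrite -/D -DE; apply: history_state; rewrite /= in_itv/= lexx.
have sC k : pr C (J i 0 @^-1` [set lshift 1 k]) = (delta_mx 0 j : 'rV_p) 0 k.
  rewrite pr_cond_prob//; last exact: (paths_measurable (pJ i)).
  rewrite mxE eqxx/= -/D; have [->|kj] := eqVneq k j.
    by rewrite DE setIid divff ?gt_eqF.
  rewrite (_ : _ `&` _ = set0) ?pr0 ?mul0r//.
  apply/seteqP; split => // w [/= + Dw].
  rewrite JJ0 (Dw : J0 w = _) => /lshift_inj jk.
  by rewrite jk eqxx in kj.
have aC : C.-negligible [set w | absorption_time (J i) w = +oo%E].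
  have my : measurable [set w | absorption_time (J i) w = +oo%E].
    exact: (history_measurable (pJ i) (fun _ h => h)
      (history_absorption_time_pinfty (paths_right_continuous (pJ i)))).
  exists [set w | absorption_time (J i) w = +oo%E]; split => //.
  rewrite prK// pr_cond_prob//.
  suff -> : pr Q ([set w | absorption_time (J i) w = +oo%E] `&` D) = 0.
    by rewrite mul0r.
  apply/eqP; rewrite eq_le pr_ge0 andbT.
  apply: (@le_trans _ _ (pr Q [set w | absorption_time (J i) w = +oo%E])).
    by apply: le_pr => //; exact: measurableI.
  by rewrite /pr finJ.
have [J' [tau [rJ' law]]] := regularize (tT i) (pJ i) iC sC aC.
have mtau := regular_time_measurable rJ'.
have v0 : 0 < (u 0 i)^-1 by rewrite invr_gt0.
exists p, (delta_mx 0 j), ((u 0 i)^-1 *: T i); split.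
- split=> [k|]; first by rewrite mxE.
  rewrite (bigD1 j)//= mxE !eqxx big1 ?addr0// => k kj.
  by rewrite mxE (negbTE kj) andbF.
- exact: scale_transient.
exists disp, Om, C, (fun t => J' ((u 0 i)^-1 * t)),
  (fun w => tau w / (u 0 i)^-1); split; first exact: regular_scale.
move=> A mA; rewrite invrK.
pose B := (fun x : R => x * u 0 i) @^-1` A.
have mB : measurable B.
  by apply: measurable_preimageT => //; exact: mulrr_measurable.
symmetry; apply: (law B); first exact: measurable_preimageT mtau mB.
exact: measurable_preimageT (@m_abs i) mB.
Qed.

(** Conditional independence given the start is plain independence under [C], and events about an
    absorption time belong to the history of its process. *)
Lemma regular_conditioned_sum : regular_phase_type
  (fun A => pr C ((fun w => \sum_i abst i w * u 0 i) @^-1` A)).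
Proof.
(* [inord] extends the family to all of [nat]; only the indices up to [d] enter the sum. *)
pose Y (i : nat) w := abst (inord i) w * u 0 (inord i).
have mY i : measurable_fun setT (Y i).
  by apply: measurable_funM; [exact: m_abs|exact: measurable_cst].
rewrite (_ : (fun w => _) = fun w => \sum_(0 <= i < d.+1) Y i w); last first.
  apply/funext => w; rewrite big_mkord; apply: eq_bigr => i _.
  by rewrite /Y inord_val.
apply: regular_phase_type_indep_sum => // [i _|B mB].
  exact: regular_conditioned.
pose E (i : 'I_d.+1) := Y i @^-1` B i.
have hE i : history (J i) `[0, +oo[ (E i).
  pose B' := (fun x : R => x * u 0 i) @^-1` B i.
  have mB' : measurable B'.
    by apply: measurable_preimageT => //; exact: mulrr_measurable.
  by have := @hist_abs i _ mB'; rewrite /E /Y inord_val.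
have mE i : measurable (E i) by exact: measurable_preimageT.
have condE A : measurable A -> condp Q A D = pr C A.
  by move=> mA; rewrite pr_cond_prob.
have EE : \bigcap_(i in [set: 'I_d.+1]) E i =
    \big[setI/setT]_(0 <= i < d.+1) (Y i @^-1` B i).
  rewrite big_mkord -(bigcap_mkord _ (fun i => Y i @^-1` B i)).
  apply/seteqP; split => w /= H i.
    by move=> id; exact: (H (Ordinal id) I).
  by move=> _; exact: (H i (ltn_ord i)).
have := indJ hE; rewrite condE EE; last first.
  by apply: bigsetI_measurable => i _; exact: measurable_preimageT.
move=> ->; rewrite big_mkord; apply: eq_bigr => i _; rewrite condE//.
Qed.

End conditioned_on_start.

Theorem corollary2p3 (R : realType) (disp : measure_display)
    (Omega : measurableType disp) (P : probability Omega R)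
    (d p : nat) (pi : 'rV[R]_p) (T : 'I_d -> 'M[R]_p)
    (X : {RV P >-> d.-tuple R}) (u : 'rV[R]_d) :
  (0 < d)%N ->
  probability_vector pi ->
  (forall i, transient_subintensity (T i)) ->
  mPH pi T X ->
  (forall i, 0 < u 0 i) ->
  phase_type (pushforward P (fun w : Omega => \sum_(i < d) tnth (X w) i * u 0 i)).
Proof.
case: d T X u => [//|d] T X u _ ppi tT [d' [Om [Q [J [[mJ [J0 [JJ0 J0pi indJ]]] law]]]]] u0.
have pJ i := markov_jump_process_paths (mJ i).
have mJ0 k : measurable (J0 @^-1` [set k]).
  rewrite (_ : _ @^-1` _ = J ord0 0 @^-1` [set k]).
    exact: (paths_measurable (pJ ord0)).
  by apply/seteqP; split => w /=; rewrite JJ0.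
pose N := \bigcup_(i in [set: 'I_d.+1]) [set w | absorption_time (J i) w = +oo%E].
have my i : measurable [set w | absorption_time (J i) w = +oo%E].
  exact: (history_measurable (pJ i) (fun _ h => h)
    (history_absorption_time_pinfty (paths_right_continuous (pJ i)))).
have mN : measurable N by apply: fin_bigcup_measurable => //; exact: finite_finset.
have m_abs i : measurable_fun setT (fun w => fine (absorption_time (J i) w)).
  move=> _ A mA; rewrite setTI.
  exact: (history_measurable (pJ i) (fun _ h => h)
    (history_absorption_time (paths_right_continuous (pJ i)) mA)).
(* Demanding real absorption times amounts to excluding [N], and outside [N] nothing is lost by
   [fine]. *)
have lawE B : [set w | exists2 x : d.+1.-tuple R, B x &
      forall i, absorption_time (J i) w = (tnth x i)%:E] =
    (fun w => [tuple fine (absorption_time (J i) w) | i < d.+1]) @^-1` B `&` ~` N.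
  apply/seteqP; split => w /=.
    move=> [x Bx xw]; split; last by move=> [i _] /=; rewrite xw.
    rewrite (_ : [tuple _ | _ < _] = x)//; apply: eq_from_tnth => i.
    by rewrite tnth_mktuple xw.
  move=> [Bw nN]; eexists; first exact: Bw.
  move=> i; rewrite tnth_mktuple fineK// ge0_fin_numE ?absorption_time_ge0//.
  by rewrite ltey; apply/eqP => wy; apply: nN; exists i.
(* The law of [X] gives mass 1 to the whole space, so all absorption times are almost surely
   finite. *)
have N0 : Q N = 0%E.
  have := law setT measurableT; rewrite lawE preimage_setT setTI.
  rewrite [LHS]probability_setT probability_setC// => /eqP.
  rewrite prK// -EFinB eqe => /eqP h; congr EFin; lra.
have finJ i : Q [set w | absorption_time (J i) w = +oo%E] = 0%E.
  apply/eqP; rewrite eq_le measure_ge0 andbT -N0 le_measure ?inE//.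
  by move=> w wy; exists i.
pose V w := \sum_i fine (absorption_time (J i) w) * u 0 i.
have mV : measurable_fun setT V.
  apply: measurable_sum => i; apply: measurable_funM; first exact: m_abs.
  exact: measurable_cst.
(* For [pi 0 j = 0] this is the default law of [cond_prob], which gets weight 0 in the mixture. *)
pose nu j A := pr (cond_prob Q (mJ0 (lshift 1 j))) (V @^-1` A).
have pi_pr j : pr Q (J0 @^-1` [set lshift 1 j]) = pi 0 j by rewrite /pr J0pi.
(* The division by the total weight, which is 1, brings the mixture to the form of
   [regular_phase_type_sum]. *)
apply: (@regular_phase_type_phase_type _ _
  (fun A => (\sum_j pi 0 j * nu j A) / \sum_j pi 0 j)); last first.
  apply: regular_phase_type_sum; [exact: (proj1 ppi)| |by rewrite (proj2 ppi)].
  move=> j; rewrite -pi_pr => pj0.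
  have iJ : (0 < Q (J0 @^-1` [set lshift 1 j]))%E by rewrite prK.
  exact: (regular_conditioned_sum u0 tT mJ JJ0 finJ (mJ0 _) pj0 (indJ _ iJ)).
move=> A mA; rewrite (proj2 ppi) divr1.
pose B := (fun x : d.+1.-tuple R => \sum_i tnth x i * u 0 i) @^-1` A.
have mB : measurable B.
  apply: measurable_preimageT mA; apply: measurable_sum => i.
  by apply: measurable_funM; [exact: measurable_tnth|exact: measurable_cst].
have mVA : measurable (V @^-1` A) by exact: measurable_preimageT.
rewrite [LHS](law B mB) lawE.
have -> : (fun w => [tuple fine (absorption_time (J i) w) | i < d.+1]) @^-1` B =
    V @^-1` A.
  rewrite /B -comp_preimage; congr (_ @^-1` A); apply/funext => w /=.
  by apply: eq_bigr => i _; rewrite tnth_mktuple.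
have mVAN : measurable (V @^-1` A `&` ~` N).
  by apply: measurableI => //; exact: measurableC.
rewrite prK//; congr EFin.
rewrite (pr_ae mN N0 mVAN mVA); last by rewrite -setIA setIid.
(* Total probability over the starting state; a start in the cemetery is null because [pi] has mass
   1. *)
rewrite (pr_fibers (K := J0) Q mJ0 mVA) big_split_ord/= big_ord1.
have J0c : pr Q (J0 @^-1` [set cemetery p]) = 0.
  have := pr_fibers (K := J0) Q mJ0 measurableT.
  rewrite prT big_split_ord/= big_ord1 setTI -/(cemetery p).
  under eq_bigr do rewrite setTI pi_pr.
  by rewrite (proj2 ppi) => ?; lra.
rewrite [X in _ + X](_ : _ = 0) ?addr0; last first.
  apply/eqP; rewrite eq_le pr_ge0 andbT -[leRHS]J0c le_pr//.
  by apply: measurableI => //; exact: mJ0.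
apply: eq_bigr => j _; rewrite /nu -pi_pr.
have [j0|j0] := eqVneq (pr Q (J0 @^-1` [set lshift 1 j])) 0.
  rewrite j0 mul0r; apply/eqP; rewrite eq_le pr_ge0 andbT -[leRHS]j0 le_pr//.
  by apply: measurableI => //; exact: mJ0.
by rewrite pr_cond_prob ?lt0r ?j0 ?pr_ge0// mulrC divfK.
Qed.
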